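(* Let $(H,K)$ be a generalized strong Shoda pair of a finite group $G$, $\lambda$ a linear character of $H$ with kernel $K$, and $H=H_0\le H_1\le\cdots\le H_n=G$ a strong inductive chain from $H$ to $G$. For $0\le i\le n-1$ let $T_i=\{t_{(i,1)},\dots,t_{(i,k_i)}\}$ be a right transversal of $C_i$ in $H_{i+1}$ with $t_{(i,1)}=1$, and let $T=T_0T_1\cdots T_{n-1}=\{t_{(0,s_0)}t_{(1,s_1)}\cdots t_{(n-1,s_{n-1})}\mid 1\le s_i\le k_i\}$. Suppose that the Schur index of $\mathbb{Q}Ge_{\mathbb{Q}}(\lambda^G)$ is $1$. Let $w$ be a normal element of $\mathbb{E}/\mathbb{F}$, let $\mathcal{G}=\operatorname{Gal}(\mathbb{E}/\mathbb{F})=\{\sigma_1,\dots,\sigma_{\mathtt{k}}\}$ with $\sigma_1$ the identity, and let $\mathbf{z}_1,\dots,\mathbf{z}_{\mathtt{k}}$ be units of $\operatorname{Cen}_{\mathcal{A}}(\mathcal{B})$, forming a basis of $\operatorname{Cen}_{\mathcal{A}}(\mathcal{B})$ as a vector space over $\mathbb{E}$, with the following properties (such units exist because the Schur index is $1$): there are $\alpha_1,\dots,\alpha_{\mathtt{k}}\in\mathbb{E}$ with $$\sum_{i=1}^{\mathtt{k}}\alpha_i\sigma_i(w)=\sum_{i=1}^{\mathtt{k}}\sigma_i(w),\qquad \sum_{i=1}^{\mathtt{k}}\alpha_i\sigma_i(\sigma_j(w))=w-\sigma_j(w)\quad(2\le j\le\mathtt{k}),$$ the element $\alpha=\sum_{i=1}^{\mathtt{k}}\alpha_i\mathbf{z}_i$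 is invertible, and, with $\widehat{E}=\frac{1}{\mathtt{k}}\sum_{i=1}^{\mathtt{k}}\mathbf{z}_i$, the set $\{\mathbf{z}_i^{-1}\alpha^{-1}\widehat{E}\alpha\mathbf{z}_i\mid 1\le i\le\mathtt{k}\}$ is a complete set of orthogonal primitive idempotents of $\operatorname{Cen}_{\mathcal{A}}(\mathcal{B})$. Then $$\{t^{-1}\mathbf{z}_i^{-1}\alpha^{-1}\widehat{E}\,\varepsilon(H,K)\,\alpha\,\mathbf{z}_{i'}\,t'\mid t,t'\in T,\ 1\le i,i'\le\mathtt{k}\}$$ is a complete set of matrix units of $\mathbb{Q}Ge_{\mathbb{Q}}(\lambda^G)$ (the element displayed being the matrix unit in row $(t,i)$ and column $(t',i')$).
   Context: All groups are finite and all characters are complex. For $g\in G$ and $\alpha\in\mathbb{Q}G$, $\alpha^g=g^{-1}\alpha g$. For an irreducible character $\chi$ of a finite group $X$, $e_{\mathbb{Q}}(\chi)=\frac{\chi(1)}{|X|}\sum_{\sigma\in\operatorname{Gal}(\mathbb{Q}(\chi)/\mathbb{Q})}\sum_{g\in X}\sigma(\chi(g))g^{-1}$, a primitive central idempotent of $\mathbb{Q}X$. Shoda pairs. A pair $(H,K)$ of subgroups of $G$ is a Shoda pair if (i) $K\unlhd H$ and $H/K$ is cyclic; (ii) if $g\in G$ and $[H,g]\cap H\subseteq K$ then $g\in H$, where $[H,g]=\langle g^{-1}h^{-1}gh\mid h\in H\rangle$. Then for every linear character $\lambda$ of $H$ with kernel $K$, the induced character $\lambda^G$ is irreducible. For a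 subgroup $X$, $\widehat{X}=\frac1{|X|}\sum_{x\in X}x$; $\varepsilon(H,K)=\widehat{K}$ if $H=K$, and otherwise $\varepsilon(H,K)=\prod_L(\widehat{K}-\widehat{L})$, $L$ running over the normal subgroups of $H$ minimal with respect to properly containing $K$; one has $e_{\mathbb{Q}}(\lambda)=\varepsilon(H,K)$. A Shoda pair $(H,K)$ is a generalized strong Shoda pair if there is a chain $H=H_0\le H_1\le\cdots\le H_n=G$ (a strong inductive chain from $H$ to $G$) such that for all $0\le i\le n-1$: $H_i\unlhd\operatorname{Cen}_{H_{i+1}}(e_{\mathbb{Q}}(\lambda^{H_i}))$, and the distinct $H_{i+1}$-conjugates of $e_{\mathbb{Q}}(\lambda^{H_i})$ are mutually orthogonal. Notation attached to $(H,K)$, $\lambda$ and the chain. Write $e_i=e_{\mathbb{Q}}(\lambda^{H_i})$. $C_i=\operatorname{Cen}_{H_{i+1}}(e_i)$, $k_i=[H_{i+1}:C_i]$, $k=k_0\cdots k_{n-1}$, $\mathtt{k}=\prod_{i=0}^{n-1}|C_i/H_i|=[G:H]/k$. A right transversal $T_i$ of $C_i$ in $H_{i+1}$ is a set of representatives of the cosets $C_it$; it contains $t_{(i,1)}=1$. The map $\theta_i:\mathbb{Q}H_{i+1}e_{i+1}\to M_{k_i}(\mathbb{Q}C_ie_i)$ sending $\beta$ to the matrix whose (row $l$, column $m$) entry is $e_it_{(i,l)}\beta t_{(i,m)}^{-1}e_i$ is an isomorphism of algebras, and $\mathbb{Q}C_ie_i\supseteq\mathbb{Q}H_ie_i$ (it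 is a crossed product of $C_i/H_i$ over $\mathbb{Q}H_ie_i$). Put $\mathcal{A}=\mathbb{Q}Ge_{\mathbb{Q}}(\lambda^G)$, identified through $\theta_{n-1},\dots,\theta_0$ with the iterated matrix/crossed product algebra over $E=\mathbb{Q}He_{\mathbb{Q}}(\lambda)=\mathbb{Q}H\varepsilon(H,K)$ (a field isomorphic to $\mathbb{Q}(\zeta_{[H:K]})$). Starting from $M_0=E$ and $M_{i+1}=\theta_i^{-1}(M_{k_i}(M_i))\subseteq\mathbb{Q}H_{i+1}e_{i+1}$, one obtains the subalgebra $M_n\subseteq\mathcal{A}$, identified by nested blocks with $M_k(E)$. Inside $M_k(E)\subseteq\mathcal{A}$: $\mathbb{E}=\{\operatorname{diag}(\beta,\dots,\beta)\mid\beta\in E\}$, $\mathbb{F}=\mathcal{Z}(\mathcal{A})$ (which is contained in $\mathbb{E}$), $F=\{\beta\in E\mid\operatorname{diag}(\beta,\dots,\beta)\in\mathbb{F}\}$, $\mathcal{B}=M_k(F)$, and $\operatorname{Cen}_{\mathcal{A}}(\mathcal{B})$ is the centralizer of $\mathcal{B}$ in $\mathcal{A}$. It is known that $\mathbb{E}/\mathbb{F}$ is Galois of degree $\mathtt{k}$, that $\operatorname{Cen}_{\mathcal{A}}(\mathcal{B})$ has dimension $\mathtt{k}^2$ over $\mathbb{F}$ and contains $\mathbb{E}$ as a maximal subfield, and that $\mathcal{A}\cong\mathcal{B}\otimes_{\mathbb{F}}\operatorname{Cen}_{\mathcal{A}}(\mathcal{B})$ via multiplication. Inverses in $\operatorname{Cen}_{\mathcal{A}}(\mathcal{B})$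 are taken with respect to the identity $e_{\mathbb{Q}}(\lambda^G)$. A normal element of a finite Galois extension $L/M$ is $w\in L$ such that $\{\sigma(w)\mid\sigma\in\operatorname{Gal}(L/M)\}$ is an $M$-basis of $L$. The Schur index of a central simple algebra $\cong M_m(D)$ ($D$ a division algebra) is the square root of the dimension of $D$ over its center. A complete set of orthogonal primitive idempotents of a semisimple ring is a finite family of non-zero, pairwise orthogonal idempotents with sum $1$, none of which is a sum of two non-zero orthogonal idempotents. A complete set of matrix units of a simple algebra isomorphic to $M_m(D)$, $D$ a division algebra, is a set of elements $E_{ij}$ ($i,j$ in an index set of size $m$) with $E_{ij}E_{rl}=\delta_{jr}E_{il}$ and $\sum_iE_{ii}=1$ (here $1$ is the identity $e_{\mathbb{Q}}(\lambda^G)$ of the component). *)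

(* Defs.v *)
From HB Require Import structures.
From mathcomp Require Import all_boot all_order all_algebra.
From mathcomp Require Import all_fingroup all_solvable all_field all_character.

Set Implicit Arguments.
Unset Strict Implicit.
Unset Printing Implicit Defensive.

Import GroupScope GRing.Theory.
Local Open Scope ring_scope.

(* The carrier is a fresh name for [{ffun gT -> rat^o}], so that the product
   below is convolution and not the pointwise product of finite functions. *)
Definition galg (gT : finGroupType) : Type := {ffun gT -> rat^o}.

Section GroupAlgebra.
Variable gT : finGroupType.

HB.instance Definition _ := Vector.copy (galg gT) {ffun gT -> rat^o}.

Definition gelt (g : gT) : galg gT := [ffun x => (x == g)%:R : rat^o].

Definition galg_mul (a b : galg gT) : galg gT :=
  [ffun g => \sum_(h : gT) (a h : rat) * (b (h^-1 * g)%g : rat) : rat^o].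

Fact galg_mulA : associative galg_mul.
Proof.
move=> a b c; apply/ffunP=> g; rewrite !ffunE.
under eq_bigr do rewrite ffunE mulr_sumr.
under [RHS]eq_bigr do rewrite ffunE mulr_suml.
rewrite [RHS]exchange_big /=; apply: eq_bigr => h _.
rewrite (reindex_inj (mulgI h^-1%g)) /=; apply: eq_bigr => k _.
by rewrite mulrA invMg invgK -mulgA mulKVg.
Qed.

Fact galg_mul1l : left_id (gelt 1) galg_mul.
Proof.
move=> a; apply/ffunP=> g; rewrite ffunE (bigD1 1%g) //= big1 ?addr0.
  by rewrite ffunE eqxx mul1r invg1 mul1g.
by move=> h /negPf nh; rewrite ffunE nh mul0r.
Qed.

Fact galg_mul1r : right_id (gelt 1) galg_mul.
Proof.
move=> a; apply/ffunP=> g; rewrite ffunE (bigD1 g) //= big1 ?addr0.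
  by rewrite ffunE mulVg eqxx mulr1.
move=> h nh; rewrite ffunE -eq_mulVg1.
by rewrite (negPf nh) mulr0.
Qed.

Fact galg_mulDl : left_distributive galg_mul +%R.
Proof.
move=> a b c; apply/ffunP=> g; rewrite !ffunE -big_split /=.
by apply: eq_bigr => h _; rewrite ffunE mulrDl.
Qed.

Fact galg_mulDr : right_distributive galg_mul +%R.
Proof.
move=> a b c; apply/ffunP=> g; rewrite !ffunE -big_split /=.
by apply: eq_bigr => h _; rewrite ffunE mulrDr.
Qed.

Fact galg_1neq0 : gelt 1 != 0.
Proof.
by apply/eqP=> /ffunP/(_ 1%g); rewrite !ffunE eqxx => /eqP; rewrite oner_eq0.
Qed.

HB.instance Definition _ := GRing.Zmodule_isNzRing.Build (galg gT)
  galg_mulA galg_mul1l galg_mul1r galg_mulDl galg_mulDr galg_1neq0.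

Fact galg_scaleAl (k : rat) (a b : galg gT) : k *: (a * b) = (k *: a) * b.
Proof.
apply/ffunP=> g; rewrite !ffunE scaler_sumr; apply: eq_bigr => h _.
by rewrite ffunE; apply: mulrA.
Qed.

Fact galg_scaleAr (k : rat) (a b : galg gT) : k *: (a * b) = a * (k *: b).
Proof.
apply/ffunP=> g; rewrite !ffunE scaler_sumr; apply: eq_bigr => h _.
by rewrite ffunE; apply: mulrCA.
Qed.

HB.instance Definition _ :=
  GRing.Lmodule_isLalgebra.Build rat (galg gT) galg_scaleAl.
HB.instance Definition _ :=
  GRing.Lalgebra_isAlgebra.Build rat (galg gT) galg_scaleAr.
HB.instance Definition _ := Algebra_isFalgebra.Build rat (galg gT).

Lemma gelt1 : gelt 1 = 1. Proof. by []. Qed.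

Lemma geltM g h : gelt (g * h) = gelt g * gelt h.
Proof.
apply/ffunP=> x; rewrite !ffunE (bigD1 g) //= big1 ?addr0.
  by rewrite !ffunE eqxx mul1r (can2_eq (mulKVg g) (mulKg g)).
by move=> k /negPf nk; rewrite ffunE nk mul0r.
Qed.

Lemma gelt_sum (a : galg gT) : a = \sum_(g : gT) (a g : rat) *: gelt g.
Proof.
apply/ffunP=> x; rewrite sum_ffunE (bigD1 x) //= big1 ?addr0.
  by rewrite !ffunE eqxx; apply/esym/mulr1.
by move=> g ng; rewrite !ffunE eq_sym (negPf ng); apply: mulr0.
Qed.

Definition gconj (a : galg gT) (g : gT) : galg gT := gelt g^-1 * a * gelt g.

Definition gcent (X : {set gT}) (a : galg gT) : {set gT} :=
  [set g in X | gconj a g == a].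

Definition gspan (X : {set gT}) : {vspace galg gT} :=
  <<[seq gelt g | g <- enum X]>>%VS.

Definition hat (X : {set gT}) : galg gT :=
  #|X|%:R^-1 *: \sum_(x in X) gelt x.

(* The factors commute pairwise, so the order of the product is irrelevant. *)
Definition varepsilon (H K : {group gT}) : galg gT :=
  if H == K then hat K
  else \prod_(L : {group gT} | [min L | (L <| H) && (K \proper L)])
         (hat K - hat L).

End GroupAlgebra.

(* A copy of a number field in which the character takes its values; the field
   of character values is the subfield [char_field] generated by them. *)
Fact char_values_subproof (gT : finGroupType) (X : {group gT}) (i : Iirr X) :
  {L : splittingFieldType rat & {iota : {rmorphism L -> algC} &
    {v : gT -> L | forall g, iota (v g) = 'chi_i g}}}.
Proof.
have [L _ [iota _ [_ _ inL]]] := group_num_field_exists X; exists L, iota.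
suffices vP g : {a | iota a = 'chi_i g}.
  by exists (fun g => sval (vP g)) => g; case: (vP g).
have [Xg | X'g] := boolP (g \in X).
  by apply: inL; [apply: irr_char | apply: order_dvdG].
by exists 0; rewrite rmorph0 cfun0.
Qed.

Section RationalIdempotent.
Variables (gT : finGroupType) (X : {group gT}) (i : Iirr X).

Definition char_ambient : splittingFieldType rat :=
  projT1 (char_values_subproof i).
Definition char_embed : {rmorphism char_ambient -> algC} :=
  projT1 (projT2 (char_values_subproof i)).
Definition char_value : gT -> char_ambient :=
  sval (projT2 (projT2 (char_values_subproof i))).

Lemma char_valueE g : char_embed (char_value g) = 'chi_i g.
Proof. exact: svalP (projT2 (projT2 (char_values_subproof i))) g. Qed.

Definition char_field : {subfield char_ambient} :=
  <<1 & [seq char_value g | g <- enum X]>>%AS.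

(* The coefficient of g^-1 is rational, whence the use of [getCrat]. *)
Definition eQ : galg gT :=
  \sum_(g in X)
     getCrat ('chi_i 1%g / #|X|%:R *
       char_embed (\sum_(s in 'Gal(char_field / 1)) s (char_value g)))
     *: gelt g^-1.

End RationalIdempotent.

(* Below, a subalgebra of [aT] is a mere subspace A closed under product, whose
   identity element e need not be 1. *)

Section Subalgebras.
Variables (K : fieldType) (aT : falgType K).
Implicit Types (A E F V : {vspace aT}) (e x y w : aT).

Definition division_algebra (D : falgType K) : Prop :=
  forall x : D, x != 0 -> x \is a GRing.unit.

Definition isom_matrix_algebra A (m : nat) (D : falgType K) : Prop :=
  exists f : aT -> 'M[D]_m,
    [/\ {in A &, {morph f : x y / x + y}},
        {in A &, {morph f : x y / x * y >-> x *m y}},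
        {in A &, injective f}
      & forall M, exists2 x, x \in A & f x = M].

Definition schur_index A (s : nat) : Prop :=
  exists m (D : falgType K),
    [/\ division_algebra D, isom_matrix_algebra A m D
      & (s ^ 2)%N = (\dim_('Z({:D})) {:D})%N].

Definition inverse_in A e x y : Prop :=
  [/\ x \in A, y \in A, x * y = e & y * x = e].

Definition left_basis F V (I : finType) (b : I -> aT) : Prop :=
  [/\ forall i, b i \in V,
      forall c : I -> aT, (forall i, c i \in F) ->
        \sum_i c i * b i = 0 -> forall i, c i = 0
    & forall v, v \in V -> exists2 c : I -> aT,
        forall i, c i \in F & v = \sum_i c i * b i].

(* For subfields F of E; only the restriction of [s] to E is meaningful. *)
Definition field_automorphism E F (s : 'End(aT)) : Prop :=
  [/\ (s @: E)%VS = E, {in E &, {morph s : x y / x * y}} & {in F, s =1 id}].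

Definition galois_enumeration E F (I : finType) (sigma : I -> 'End(aT)) : Prop :=
  [/\ forall i, field_automorphism E F (sigma i),
      forall i j, {in E, sigma i =1 sigma j} -> i = j
    & forall s, field_automorphism E F s -> exists i, {in E, s =1 sigma i}].

Definition normal_element E F (I : finType) (sigma : I -> 'End(aT)) w : Prop :=
  w \in E /\ left_basis F E (fun i => sigma i w).

Definition nonzero_idempotent A x : Prop :=
  [/\ x \in A, x != 0 & x * x = x].

Definition primitive_in A x : Prop :=
  ~ exists y z, [/\ nonzero_idempotent A y, nonzero_idempotent A z,
                    y * z = 0, z * y = 0 & x = y + z].

Definition complete_primitive_idempotents A e (I : finType) (f : I -> aT) : Prop :=
  [/\ forall i, nonzero_idempotent A (f i),
      forall i j, i != j -> f i * f j = 0,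
      \sum_i f i = e
    & forall i, primitive_in A (f i)].

Definition complete_matrix_units A e (I : finType) (J : {set I})
    (u : I -> I -> aT) : Prop :=
  [/\ forall i j, i \in J -> j \in J -> u i j \in A,
      forall i j r l, i \in J -> j \in J -> r \in J -> l \in J ->
        u i j * u r l = if j == r then u i l else 0,
      \sum_(i in J) u i i = e
    & exists D : falgType K, division_algebra D /\ isom_matrix_algebra A #|J| D].

End Subalgebras.

Section ShodaPairs.
Variables (gT : finGroupType).

(* In the library [~ g, h] = g^-1 h^-1 g h, so [~: [set g], H] is generated by
   exactly the elements in the definition of [H, g]. *)
Definition shoda_pair (G H K : {group gT}) : Prop :=
  [/\ H \subset G, K <| H, cyclic (H / K)
    & forall g, g \in G -> [~: [set g], H] :&: H \subset K -> g \in H].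

Variables (H : {group gT}) (lambda : 'CF(H)).

(* [cfIirr] turns an irreducible class function into its index. *)
Definition ind_idem (X : {group gT}) : galg gT := eQ (cfIirr ('Ind[X] lambda)).

Definition component (X : {group gT}) : {vspace galg gT} :=
  (gspan X * <[ind_idem X]>)%VS.

Variable Hc : nat -> {group gT}.

Definition chain_e (i : nat) : galg gT := ind_idem (Hc i).

Definition chain_C (i : nat) : {set gT} := gcent (Hc i.+1) (chain_e i).

Definition strong_inductive_chain (G : {group gT}) (n : nat) : Prop :=
  [/\ Hc 0 = H, Hc n = G
    & forall i, (i < n)%N ->
      [/\ Hc i \subset Hc i.+1, Hc i <| chain_C i
        & forall g h, g \in Hc i.+1 -> h \in Hc i.+1 ->
            gconj (chain_e i) g != gconj (chain_e i) h ->
            gconj (chain_e i) g * gconj (chain_e i) h = 0]].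

Definition chain_kk (n : nat) : nat := \prod_(i < n) #|(chain_C i / Hc i)%g|.

(* [T i] is a right transversal of [chain_C i] in [Hc i.+1]. *)
Variable T : nat -> {set gT}.

Definition chain_V (i : nat) : {vspace galg gT} := component (Hc i).

(* Matrices with rows and columns indexed by [T i] are extended by 0 to
   [gT * gT]. *)
Definition theta_fun (i : nat) (b : galg gT) : {ffun gT * gT -> galg gT} :=
  [ffun p => if (p.1 \in T i) && (p.2 \in T i)
             then chain_e i * gelt p.1 * b * gelt p.2^-1 * chain_e i else 0].

Fact theta_fun_is_linear i : linear (theta_fun i).
Proof.
move=> k a b; apply/ffunP=> p; rewrite !ffunE; case: ifP => _.
  by rewrite mulrDr !mulrDl -scalerAr -!scalerAl.
by rewrite scaler0 addr0.
Qed.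
HB.instance Definition _ i :=
  GRing.isLinear.Build rat (galg gT) {ffun gT * gT -> galg gT} _ (theta_fun i)
    (theta_fun_is_linear i).

Definition theta i : 'Hom(galg gT, {ffun gT * gT -> galg gT}) :=
  linfun (theta_fun i).

Lemma thetaE i b t t' : t \in T i -> t' \in T i ->
  theta i b (t, t') = chain_e i * gelt t * b * gelt t'^-1 * chain_e i.
Proof. by move=> Tt Tt'; rewrite lfunE ffunE /= Tt Tt'. Qed.

(* The inverse of the restriction of [theta i] to [chain_V i.+1]: for m in the
   image of this restriction, an element of [chain_V i.+1] mapped to m. *)
Definition theta_inv i : 'Hom({ffun gT * gT -> galg gT}, galg gT) :=
  (projv (chain_V i.+1) \o (theta i \o projv (chain_V i.+1))^-1)%VF.

Lemma theta_invK i m : m \in (theta i @: chain_V i.+1)%VS ->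
  theta_inv i m \in chain_V i.+1 /\ theta i (theta_inv i m) = m.
Proof.
case/memv_imgP=> x Vx ->; rewrite comp_lfunE /= memv_proj; split=> //.
rewrite -[RHS](limg_lfunVK (f := (theta i \o projv (chain_V i.+1))%VF)).
  by rewrite comp_lfunE.
by apply/memv_imgP; exists x; rewrite ?memvf // comp_lfunE /= projv_id.
Qed.

Definition entry (p : gT * gT) (m : {ffun gT * gT -> galg gT}) : galg gT := m p.
Fact entry_is_linear p : linear (entry p).
Proof. by move=> k a b; rewrite /entry !ffunE. Qed.
HB.instance Definition _ p :=
  GRing.isLinear.Build rat {ffun gT * gT -> galg gT} (galg gT) _ (entry p)
    (entry_is_linear p).

(* [nested_matrices S n] is M_k(S), for S a subspace of [chain_V 0]; with S the
   whole of [chain_V 0] one recovers the subalgebras M_i. *)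
Fixpoint nested_matrices (S : {vspace galg gT}) (n : nat) : {vspace galg gT} :=
  if n is i.+1 then
    (chain_V i.+1 :&: \bigcap_(p in setX (T i) (T i))
       ((linfun (entry p) \o theta i) @^-1: nested_matrices S i))%VS
  else S.

Definition scalar_block (i : nat) (b : galg gT) : {ffun gT * gT -> galg gT} :=
  [ffun p => if (p.1 \in T i) && (p.1 == p.2) then b else 0].
Fact scalar_block_is_linear i : linear (scalar_block i).
Proof.
move=> k a b; apply/ffunP=> p; rewrite !ffunE; case: ifP => // _.
by rewrite scaler0 addr0.
Qed.
HB.instance Definition _ i :=
  GRing.isLinear.Build rat (galg gT) {ffun gT * gT -> galg gT} _ (scalar_block i)
    (scalar_block_is_linear i).

(* The map sending b to diag(b,...,b), one nesting level at a time. *)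
Fixpoint nested_diag (n : nat) : 'End(galg gT) :=
  if n is i.+1 then
    (theta_inv i \o (linfun (scalar_block i) \o nested_diag i))%VF
  else \1%VF.

Variable n : nat.

Definition comp_A : {vspace galg gT} := chain_V n.
Definition base_E : {vspace galg gT} := chain_V 0.
Definition diag_E : {vspace galg gT} := (nested_diag n @: base_E)%VS.
Definition center_F : {vspace galg gT} := 'Z(comp_A)%VS.
Definition base_F : {vspace galg gT} :=
  (base_E :&: nested_diag n @^-1: center_F)%VS.
Definition alg_B : {vspace galg gT} := nested_matrices base_F n.
Definition cent_B : {vspace galg gT} := 'C_comp_A(alg_B)%VS.

End ShodaPairs.

Definition generalized_strong_shoda_pair (gT : finGroupType)
    (G H K : {group gT}) : Prop :=
  shoda_pair G H K /\
  exists lambda : 'CF(H), exists Hc : nat -> {group gT}, exists n,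
    [/\ lambda \is a linear_char, cfker lambda = K
      & strong_inductive_chain lambda Hc G n].

(* Main.v *)
Require Import Defs.
From HB Require Import structures.
From mathcomp Require Import all_boot all_order all_algebra.
From mathcomp Require Import all_fingroup all_solvable all_field all_character.

Set Implicit Arguments.
Unset Strict Implicit.
Unset Printing Implicit Defensive.

Import GroupScope GRing.Theory.
Local Open Scope ring_scope.

(* Put e_0 = e_Q(lambda) = varepsilon H K and E_(t,t') = t^-1 e_0 t' for t, t' in
   the product T of the transversals.  Since e_(i+1) is the orthogonal sum of the
   conjugates of e_i by T_i, the E_(t,t') are matrix units in B with sum
   e_Q(lambda^G), and Cen is exactly their centralizer.  For c in Cen one has
   t^-1 c e_0 t' = c E_(t,t'), so the displayed elements are the products
   c_(i,i') E_(t,t') with c_(i,i') = z_i^-1 alpha^-1 Ehat alpha z_i', and these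
   are matrix units of A because the c_(i,i') are matrix units of Cen.  Their
   number N = k kk is the full matrix size: comparing dimensions,
   dim A = N^2 dim F, while A = M_m(D) with D = Z(D) of the dimension of F gives
   dim A = m^2 dim F. *)

(** * Galois orbits of irreducible characters *)

(** The sum of all conjugates of e_i under H_(i+1) is a multiple of e_(i+1): it is governed by a
    Galois-invariant character, in which the conjugates of the induced character occur equally
    often. The sum over T_i is then a nonzero idempotent proportional to e_(i+1), hence equal to it.
    This needs irreducible induced characters along the chain, which are extracted from the Shoda
    condition and from [diag_E] being nonzero, a consequence of the normal basis. The identity
    e_Q(lambda) = varepsilon H K is checked by evaluation at the linear characters of H trivial on
    K. The c_(i,i') inherit their relations from the diagonal ones because the z_i are units: with P
    = alpha^-1 Ehat alpha, orthogonality of c_(i,i) and c_(j,j) amounts to P z_i z_j^-1 P = 0. The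
    center F is a mere subspace of the rational group algebra, so dimensions are over Q and dim A is
    squeezed: spanning families of A over Cen, of Cen over EE and of EE over F bound it above,
    independence of the N^2 matrix units over F bounds it below. *)

Section GaloisOrbit.

Variables (gT : finGroupType) (X : {group gT}).
Implicit Types (i j : Iirr X) (u : {rmorphism algC -> algC}).

Lemma aut_power_exists u m : (0 < m)%N ->
  exists k, forall z, z ^+ m = 1 -> u z = z ^+ k.
Proof.
move=> m_gt0; have [z0 prim_z0] := C_prim_root_exists m_gt0.
have [k _ u_z0] := aut_prim_rootP u prim_z0; exists k => z.
by case/(prim_rootP prim_z0)=> a ->; rewrite rmorphXn /= u_z0 exprAC.
Qed.

(** On [<[g]>] the character is a sum of linear characters, whose values at [g] are [#|X|]-th roots
    of unity, where [u] is known. *)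
Lemma aut_char_expg u k (chi : 'CF(X)) g :
    (forall z, z ^+ #|X| = 1 -> u z = z ^+ k) ->
    chi \is a character -> g \in X ->
  u (chi g) = chi (g ^+ k)%g.
Proof.
move=> u_root Nchi Xg; have sgX : <[g]> \subset X by rewrite cycle_subG.
rewrite -!(cfResE chi sgX) ?cycle_id ?mem_cycle //.
have [r ->] := char_sum_irr (cfRes_char <[g]> Nchi).
rewrite !sum_cfunE rmorph_sum; apply: eq_bigr => l _.
have lin_l : 'chi_l \is a linear_char by apply/irr_cyclic_lin/cycle_cyclic.
rewrite lin_charX ?cycle_id // u_root //.
by rewrite -lin_charX ?cycle_id // expg_cardG // lin_char1.
Qed.

(** Phrased with the Galois group over which [eQ] sums; [galois_orbitP] trades it for automorphisms
    of [algC], which act on characters by [cfAut]. *)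
Definition galois_orbit i : {set Iirr X} :=
  [set j | [exists s in 'Gal(char_field i / 1%AS),
             [forall g in X, 'chi_j g == char_embed i (s (char_value i g))]]].

Lemma char_value_in_field i g : g \in X -> char_value i g \in char_field i.
Proof.
by move=> Xg; apply/seqv_sub_adjoin/mapP; exists g; rewrite ?mem_enum.
Qed.

(* Every automorphism raises the roots of unity of order |X| to a fixed power,
   so it sends each character value to another one: [char_field i] is stable,
   and all the Galois conjugates of ['chi_i] come from 'Gal(char_field i / 1). *)
Lemma gal_of_aut u i : exists2 s, s \in 'Gal(char_field i / 1%AS) &
  forall g, g \in X ->
    char_embed i (s (char_value i g)) = u (char_embed i (char_value i g)).
Proof.
have [k u_root] := aut_power_exists u (cardG_gt0 X).
have [phi Dphi] := restrict_aut_to_normal_num_field (char_embed i) u.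
have phi_value g : g \in X -> phi (char_value i g) = char_value i (g ^+ k)%g.
  move=> Xg; apply: (fmorph_inj (char_embed i)); rewrite Dphi !char_valueE.
  exact: aut_char_expg (irr_char i) Xg.
pose f : 'AEnd(char_ambient i) := linfun phi.
have autphi : kAut 1 (char_field i) f.
  rewrite /kAut; apply/andP; split.
    apply/kHomP; split=> [x y _ _|x /vlineP[c ->]]; rewrite ?rmorphM //.
    by rewrite linearZ /= rmorph1.
  have lker0 : lker f == 0%VS.
    by apply/lker0P => x y; rewrite !lfunE; apply: fmorph_inj.
  rewrite eqEdim limg_dim_eq ?(eqP lker0) ?capv0 // leqnn andbT.
  rewrite aimg_adjoin_seq aimg1; apply/Fadjoin_seqP; split; first exact: sub1v.
  move=> _ /mapP[_ /mapP[g Xg ->] ->]; rewrite mem_enum in Xg.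
  by rewrite lfunE /= phi_value // char_value_in_field // groupX.
have [s Gs Ds] := kAut_to_gal autphi; exists s => // g Xg.
by rewrite -Dphi -Ds ?char_value_in_field // lfunE.
Qed.

Lemma galois_orbitP i j :
  reflect (exists u, 'chi_j = cfAut u 'chi_i) (j \in galois_orbit i).
Proof.
rewrite inE; apply: (iffP exists_inP) => [[s _ /forall_inP Ds] | [u Du]].
  have [u Du] := extend_algC_subfield_aut (char_embed i) (gal_repr s).
  exists u; apply/cfun_inP => g Xg.
  by rewrite cfunE (eqP (Ds g Xg)) -(char_valueE i); apply: Du.
have [s Gs Ds] := gal_of_aut u i; exists s => //.
by apply/forall_inP => g Xg; rewrite Du cfunE -char_valueE Ds.
Qed.

Lemma galois_orbit_refl i : i \in galois_orbit i.
Proof.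
by apply/galois_orbitP; exists idfun; apply/cfunP=> g; rewrite cfunE.
Qed.

Lemma galois_orbit_aut u i j :
  (aut_Iirr u j \in galois_orbit i) = (j \in galois_orbit i).
Proof.
apply/idP/idP=> [/galois_orbitP[v Dv] | /galois_orbitP[v Dv]].
  apply/galois_orbitP; exists (algC_invaut u \o v)%FUN.
  apply/cfunP=> g; rewrite cfunE /=.
  by move/cfunP/(_ g): Dv; rewrite aut_IirrE !cfunE => <-; rewrite algC_autK.
apply/galois_orbitP; exists (u \o v)%FUN.
by apply/cfunP=> g; rewrite aut_IirrE Dv !cfunE.
Qed.

Lemma galois_orbit_degree i j : j \in galois_orbit i -> 'chi_j 1%g = 'chi_i 1%g.
Proof. by case/galois_orbitP=> u ->; rewrite cfAut_char1 ?irr_char. Qed.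

Lemma galois_orbit0 : galois_orbit 0 = [set 0].
Proof.
apply/setP=> j; rewrite in_set1; apply/idP/eqP=> [/galois_orbitP[u Dj] | ->].
  by apply: irr_inj; rewrite Dj -aut_IirrE aut_Iirr0.
exact: galois_orbit_refl.
Qed.

(** Every Galois automorphism of [L] over the rationals extends to [algC], so [x] lies in the fixed
    field of the Galois group, which is the prime field. *)
Lemma Crat_fixed (L : splittingFieldType rat) (iota : {rmorphism L -> algC}) x :
  (forall u, u (iota x) = iota x) -> iota x \in Crat.
Proof.
move=> fix_x; have galL : galois 1 {:L}.
  apply/and3P; split; rewrite ?sub1v ?normalFieldf //.
  apply/separableP=> y _; apply: pcharf0_separable.
  exact: ftrans (pchar_lalg L) (@Num.Theory.pchar_num _).
have /galois_fixedField defL := galL.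
have : x \in fixedField 'Gal({:L} / 1%AS).
  apply/fixedFieldP; rewrite ?memvf // => s _.
  have [u Du] := extend_algC_subfield_aut iota (gal_repr s).
  by apply: (fmorph_inj iota); rewrite Du.
by rewrite defL => /vlineP[c ->]; rewrite rmorphZ_num rmorph1 mulr1 Crat_rat.
Qed.

(** The Galois group acts simply transitively on the orbit, so the trace of a character value
    becomes a sum over characters. *)
Lemma gal_sum_orbit i g : g \in X ->
  char_embed i (\sum_(s in 'Gal(char_field i / 1%AS)) s (char_value i g)) =
    \sum_(j in galois_orbit i) 'chi_j g.
Proof.
have conjP (s : gal_of (char_field i)) :
    {j : Iirr X | [forall h in X, 'chi_j h == char_embed i (s (char_value i h))]}.
  have [u Du] := extend_algC_subfield_aut (char_embed i) (gal_repr s).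
  exists (aut_Iirr u i); apply/forall_inP=> h Xh.
  by rewrite aut_IirrE cfunE -(char_valueE i) Du.
pose cj s := sval (conjP s).
have cjE s h : h \in X -> 'chi_(cj s) h = char_embed i (s (char_value i h)).
  by move=> Xh; have /forall_inP/(_ h Xh)/eqP := svalP (conjP s).
move=> Xg; have inj_cj : {in 'Gal(char_field i / 1%AS) &, injective cj}.
  move=> s t Gs Gt eq_st; apply/eqP/gal_eqP.
  (* If [s] and [t] agree on the character values, [s * t^-1] fixes the generators of [char_field],
     hence all of it. *)
  have fix_E : (char_field i <= fixedField [set s * t^-1]%g)%VS.
    apply/Fadjoin_seqP; split; first exact: sub1v.
    move=> _ /mapP[h Xh ->]; rewrite mem_enum in Xh.
    have Ev := char_value_in_field i Xh.
    apply/fixedFieldP=> // _ /set1P->; rewrite galM //.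
    have ->: s (char_value i h) = t (char_value i h).
      by apply: (fmorph_inj (char_embed i)); rewrite -!cjE // eq_st.
    by rewrite -galM // mulgV gal_id.
  move=> x Ex; have/fixedFieldP/(_ _ (set11 _)) fx := subvP fix_E x Ex.
  by rewrite -[in RHS]fx // -galM ?mulgKV.
rewrite rmorph_sum /= (eq_bigr (fun s => 'chi_(cj s) g)) => [|s _]; last first.
  by rewrite cjE.
rewrite -(big_imset (fun j => 'chi_j g)) //; apply: eq_bigl => j.
rewrite [RHS]inE; apply/imsetP/exists_inP=> [[s Gs ->] | [s Gs /forall_inP Dj]].
  by exists s => //; apply: svalP (conjP s).
exists s => //; apply/irr_inj/cfun_inP=> h Xh.
by rewrite (eqP (Dj h Xh)) cjE.
Qed.

Lemma sum_galois_orbit_aut u i g :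
  u (\sum_(j in galois_orbit i) 'chi_j g) = \sum_(j in galois_orbit i) 'chi_j g.
Proof.
rewrite rmorph_sum [RHS](reindex_inj (aut_Iirr_inj u)) /=.
apply: eq_big => [j | j _]; first by rewrite galois_orbit_aut.
by rewrite aut_IirrE cfunE.
Qed.

Lemma sum_galois_orbit_rat i g : \sum_(j in galois_orbit i) 'chi_j g \in Crat.
Proof.
have [Xg | X'g] := boolP (g \in X); last first.
  by rewrite big1 ?rpred0 // => j _; rewrite cfun0.
rewrite -gal_sum_orbit //; apply: Crat_fixed => u.
by rewrite gal_sum_orbit // sum_galois_orbit_aut.
Qed.

(** The working form of [eQ]: the orbit sum is rational, so [getCrat] loses nothing and coefficients
    can be computed in [algC]. *)
Lemma eQ_coef i g : ratr (eQ i g : rat) =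
  'chi_i 1%g / #|X|%:R * \sum_(j in galois_orbit i) 'chi_j g^-1%g.
Proof.
rewrite /eQ sum_ffunE; have [Xg | X'g] := boolP (g \in X); last first.
  rewrite big1 ?rmorph0 => [|h Xh].
    by rewrite big1 ?mulr0 // => j _; rewrite cfun0 ?groupV.
  rewrite !ffunE; case: eqP => [Dg | _]; last exact: mulr0.
  by rewrite Dg groupV Xh in X'g.
rewrite (bigD1 g^-1%g) ?groupV //= [X in _ + X]big1 => [|h /andP[Xh neq_h]].
  rewrite addr0 !ffunE invgK eqxx gal_sum_orbit ?groupV //.
  rewrite [_ *: _]mulr1 getCratK //.
  rewrite rpredM ?sum_galois_orbit_rat // rpred_div ?rpred_nat //.
  by rewrite irr1_degree rpred_nat.
rewrite !ffunE; case: eqP => [Dg | _]; last exact: mulr0.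
by rewrite Dg invgK eqxx in neq_h.
Qed.

End GaloisOrbit.

(** * Idempotents of the rational group algebra *)

Section GroupAlgebraTheory.

Variable gT : finGroupType.
Implicit Types (X Y : {group gT}) (a b x : galg gT) (g h : gT).

Lemma galg_mulE a b g :
  ((a * b) g : rat) = \sum_(h : gT) (a h : rat) * (b (h^-1 * g)%g : rat).
Proof. exact: ffunE. Qed.

Lemma geltV_mul g : gelt g^-1 * gelt g = 1.
Proof. by rewrite -geltM mulVg. Qed.

Lemma gelt_mulV g : gelt g * gelt g^-1 = 1.
Proof. by rewrite -geltM mulgV. Qed.

Lemma galg_mul_gelt a g h : (a * gelt g) h = a (h * g^-1)%g.
Proof.
rewrite [LHS]galg_mulE (bigD1 (h * g^-1)%g) //= big1 => [|k neq_k].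
  by rewrite addr0 ffunE invMg invgK mulgKV eqxx mulr1.
rewrite ffunE; case: eqP => [Dg|_]; last by rewrite mulr0.
by rewrite -Dg invMg invgK mulKVg eqxx in neq_k.
Qed.

Lemma galg_gelt_mul a g h : (gelt g * a) h = a (g^-1 * h)%g.
Proof.
rewrite [LHS]galg_mulE (bigD1 g) //= big1 => [|k neq_k].
  by rewrite addr0 ffunE eqxx mul1r.
by rewrite ffunE (negPf neq_k) mul0r.
Qed.

Lemma gconjE a g h : gconj a g h = a (g * h * g^-1)%g.
Proof. by rewrite galg_mul_gelt galg_gelt_mul invgK mulgA. Qed.

Lemma gconjM a g h : gconj a (g * h)%g = gconj (gconj a g) h.
Proof. by rewrite /gconj invMg !geltM !mulrA. Qed.

Lemma gconj1 a : gconj a 1%g = a.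
Proof. by rewrite /gconj invg1 gelt1 mul1r mulr1. Qed.

Lemma gconj_mul a b g : gconj (a * b) g = gconj a g * gconj b g.
Proof. by rewrite /gconj !mulrA -[_ * gelt g * _]mulrA gelt_mulV mulr1. Qed.

Lemma gconj_fixP a g : reflect (a * gelt g = gelt g * a) (gconj a g == a).
Proof.
rewrite /gconj; apply: (iffP eqP) => [{2}<- | Da].
  by rewrite !mulrA gelt_mulV mul1r.
by rewrite -mulrA Da mulrA geltV_mul mul1r.
Qed.

Lemma galg_ratr_inj a b :
  (forall g, ratr (a g : rat) = ratr (b g : rat) :> algC) -> a = b.
Proof. by move=> eq_ab; apply/ffunP=> g; apply: fmorph_inj (eq_ab g). Qed.

Lemma ratr_galg_mul a b g : ratr ((a * b) g : rat) =
  \sum_h ratr (a h : rat) * ratr (b (h^-1 * g)%g : rat) :> algC.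
Proof.
by rewrite galg_mulE rmorph_sum; apply: eq_bigr => h _; rewrite rmorphM.
Qed.

Lemma gspanP (A : {set gT}) x :
  reflect (forall g, g \notin A -> x g = 0) (x \in gspan A).
Proof.
apply: (iffP idP) => [|x0].
  move=> /(@coord_span _ _ _ (in_tuple _))-> g A'g.
  rewrite sum_ffunE big1 // => i _; rewrite ffunE.
  have /mapP[h Ah ->] := mem_nth 0 (ltn_ord i).
  rewrite ffunE; case: eqP => [Dg | _]; last exact: mulr0.
  by rewrite mem_enum -Dg (negPf A'g) in Ah.
rewrite [x]gelt_sum rpred_sum // => g _; have [Ag | A'g] := boolP (g \in A).
  by rewrite memvZ ?memv_span // map_f ?mem_enum.
by rewrite x0 // scale0r mem0v.
Qed.

Lemma gelt_gspan (A : {set gT}) g : g \in A -> gelt g \in gspan A.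
Proof. by move=> Ag; rewrite memv_span // map_f ?mem_enum. Qed.

Lemma gspanS (A B : {set gT}) : A \subset B -> (gspan A <= gspan B)%VS.
Proof.
move/subsetP=> sAB; apply/span_subvP=> _ /mapP[g Ag ->].
by apply/gelt_gspan/sAB; rewrite -mem_enum.
Qed.

Lemma gspan_sum (A : {set gT}) x : x \in gspan A ->
  x = \sum_(g in A) (x g : rat) *: gelt g.
Proof.
move/gspanP=> x0; rewrite {1}[x]gelt_sum [LHS](bigID [in A]) /=.
by rewrite [X in _ + X]big1 ?addr0 // => g A'g; rewrite x0 // scale0r.
Qed.

Lemma gspanM X x y : x \in gspan X -> y \in gspan X -> x * y \in gspan X.
Proof.
move=> /gspan_sum-> /gspan_sum->; rewrite mulr_suml rpred_sum // => g Xg.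
rewrite mulr_sumr rpred_sum // => h Xh.
by rewrite -scalerAl -scalerAr -geltM !memvZ // gelt_gspan ?groupM.
Qed.

Lemma gconj_gspan X x g : x \in gspan X -> g \in X -> gconj x g \in gspan X.
Proof. by move=> Hx Xg; rewrite !gspanM ?gelt_gspan ?groupV. Qed.

Lemma gspan_comm (A : {set gT}) x y :
  {in A, forall g, x * gelt g = gelt g * x} -> y \in gspan A -> x * y = y * x.
Proof.
move=> cx /gspan_sum->; rewrite mulr_suml mulr_sumr; apply: eq_bigr => g Ag.
by rewrite -scalerAl -scalerAr cx.
Qed.

End GroupAlgebraTheory.

Section RationalIdempotentTheory.

Variables (gT : finGroupType) (X : {group gT}).
Implicit Types (i j : Iirr X).

Lemma eQ_gspan i : eQ i \in gspan X.
Proof.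
by apply: rpred_sum => g Xg; rewrite memvZ // gelt_gspan ?groupV.
Qed.

Lemma eQ_central i g : g \in X -> eQ i * gelt g = gelt g * eQ i.
Proof.
move=> Xg; apply/gconj_fixP/eqP/galg_ratr_inj=> h; rewrite gconjE !eQ_coef.
congr (_ * _); apply: eq_bigr => j _.
have ->: ((g * h * g^-1)^-1 = h^-1 ^ g^-1)%g by rewrite conjgE !invMg invgK !mulgA.
by rewrite cfunJ ?groupV.
Qed.

(** The square expands into convolutions of characters of the orbit; the generalized orthogonality
    relation kills those of two different characters. *)
Lemma eQ_idem i : eQ i * eQ i = eQ i.
Proof.
apply/galg_ratr_inj=> g; rewrite ratr_galg_mul eQ_coef.
have nz_chi : 'chi_i 1%g != 0 := irr1_neq0 i.
transitivity (\sum_h ('chi_i 1%g / #|X|%:R) ^+ 2 *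
  \sum_(j in galois_orbit i) \sum_(l in galois_orbit i)
     'chi_l (h * g^-1)%g * 'chi_j h^-1%g).
  apply: eq_bigr => h _; rewrite !eQ_coef invMg invgK.
  rewrite mulrACA -expr2; congr (_ * _).
  rewrite mulr_suml; apply: eq_bigr => j _; rewrite mulr_sumr.
  apply: eq_bigr => l _; rewrite mulrC.
  have [Xh | X'h] := boolP (h \in X); last first.
    by rewrite (cfun0 'chi_j) ?groupV // !mulr0.
  (* Conjugation by [h] brings the argument to the shape of the orthogonality relation. *)
  have ->: (g^-1 * h = (h * g^-1) ^ h)%g by rewrite conjgE !mulgA mulVg mul1g.
  by rewrite cfunJ.
have conv l j : \sum_h 'chi_l (h * g^-1)%g * 'chi_j h^-1%g =
    (l == j)%:R * (#|X|%:R * ('chi_l g^-1%g / 'chi_l 1%g)).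
  rewrite mulrCA -generalized_orthogonality_relation mulVKf ?neq0CG //.
  rewrite [LHS](bigID [in X]) /= [X in _ + X]big1 ?addr0 // => h X'h.
  by rewrite (cfun0 'chi_j) ?groupV // mulr0.
rewrite -mulr_sumr exchange_big /= !mulr_sumr; apply: eq_bigr => j Oj.
rewrite exchange_big /= (bigD1 j) //= [X in _ + X]big1 => [|l /andP[_ /negPf neq_lj]].
  rewrite addr0 conv eqxx mul1r (galois_orbit_degree Oj) expr2.
  rewrite -mulrA [X in _ * X]mulrA divfK ?neq0CG //.
  by rewrite [X in _ * X]mulrC divfK.
by rewrite conv neq_lj mul0r.
Qed.

(** The coefficient at 1 is a positive multiple of the size of the orbit. *)
Lemma eQ_neq0 i : eQ i != 0.
Proof.
apply/eqP=> e0; have := eQ_coef i 1%g; rewrite e0 ffunE rmorph0 invg1.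
rewrite (eq_bigr (fun=> 'chi_i 1%g)) => [|j Oj]; last exact: galois_orbit_degree.
move/esym/eqP; apply/negP; rewrite sumr_const.
rewrite mulf_neq0 ?mulf_neq0 ?invr_eq0 ?irr1_neq0 ?neq0CG //.
rewrite Num.Theory.mulrn_eq0 negb_or irr1_neq0 andbT -lt0n.
by apply/card_gt0P; exists i; apply: galois_orbit_refl.
Qed.

End RationalIdempotentTheory.

(** Here [b * a = b], so [c *: b = b * (c *: a) = b * b = b] and [c = 1]. This spares the
    computation of [c] in the application. *)
Lemma proportional_idempotents (F : fieldType) (R : algType F) (a b : R) (c : F) :
  a * a = a -> b * b = b -> b != 0 -> b = c *: a -> b = a.
Proof.
move=> aa bb nz_b Db; have ba : b * a = b by rewrite Db -scalerAl aa.
have /eqP : (c - 1) *: b = 0.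
  by rewrite scalerBl scale1r -[X in c *: X]ba scalerAr -Db bb subrr.
rewrite scaler_eq0 (negPf nz_b) orbF subr_eq0 => /eqP c1.
by rewrite Db c1 scale1r.
Qed.

(** * Sums of conjugates of an idempotent and induction *)

Section InducedIdempotent.

Variables (gT : finGroupType) (X Y : {group gT}) (i : Iirr X) (k : Iirr Y).
Hypotheses (sXY : X \subset Y) (Dk : 'chi_k = 'Ind[Y] 'chi_i).

Let S : 'CF(Y) := \sum_(l in galois_orbit i) 'Ind[Y] 'chi_l.

Let S_aut u : cfAut u S = S.
Proof.
apply/cfunP=> g; rewrite cfunE !sum_cfunE rmorph_sum.
rewrite [RHS](reindex_inj (aut_Iirr_inj u)) /=.
apply: eq_big => [j | j _]; first by rewrite galois_orbit_aut.
by rewrite aut_IirrE -cfAutInd [RHS]cfunE.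
Qed.

Let S_char : S \is a character.
Proof. by apply: rpred_sum => l _; rewrite cfInd_char ?irr_char. Qed.

(* S is a Galois-invariant sum of conjugates of ['chi_k], so all the conjugates
   have the same multiplicity in S. *)
Let S_orbit : S = '[S, 'chi_k] *: \sum_(j in galois_orbit k) 'chi_j.
Proof.
rewrite {1}[S]cfun_sum_cfdot (bigID [in galois_orbit k]) /=.
rewrite [X in _ + X]big1 ?addr0 => [|j notOj].
  rewrite scaler_sumr; apply: eq_bigr => j /galois_orbitP[u Dj].
  congr (_ *: _); rewrite Dj -[in LHS](S_aut u) cfdot_aut_irr.
  have /Num.Theory.natrP[n ->] : '[S, 'chi_k] \is a Num.nat.
    by rewrite Cnat_cfdot_char ?irr_char.
  exact: rmorph_nat.
rewrite cfdot_suml big1 ?scale0r // => l /galois_orbitP[u Dl].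
rewrite Dl -cfAutInd -Dk -aut_IirrE cfdot_irr; case: eqP => // Dj.
by rewrite -Dj galois_orbit_aut galois_orbit_refl in notOj.
Qed.

(** By the formula for induced characters, the coefficient of the sum at [g] is ['chi_i 1] times
    [S g^-1]; [S_orbit] makes this proportional to the coefficient of [eQ k]. *)
Lemma gconj_sum_eQ : exists c : rat, \sum_(y in Y) gconj (eQ i) y = c *: eQ k.
Proof.
have [n Dn] : exists n : nat, '[S, 'chi_k] = n%:R.
  by apply/Num.Theory.natrP; rewrite Cnat_cfdot_char ?irr_char.
exists ((irr_degree (socle_of_Iirr i))%:R * n%:R * #|Y|%:R
          / (irr_degree (socle_of_Iirr k))%:R).
apply: galg_ratr_inj => g; rewrite sum_ffunE rmorph_sum /= ffunE.
rewrite [_ *: _]/(_ * _ : rat) rmorphM /= eQ_coef.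
rewrite fmorph_div !rmorphM !rmorph_nat -!irr1_degree /=.
transitivity ('chi_i 1%g * S g^-1%g); last first.
  rewrite [in LHS]S_orbit cfunE sum_cfunE Dn.
  by rewrite -!mulrA (mulKf (irr1_neq0 k)) mulVKf ?neq0CG.
rewrite sum_cfunE mulr_sumr.
transitivity ('chi_i 1%g / #|X|%:R * \sum_(y in Y) \sum_(l in galois_orbit i)
   'chi_l (g^-1 ^ y)%g).
  rewrite mulr_sumr [LHS](reindex_inj invg_inj).
  apply: eq_big => [y | y _]; first by rewrite groupV.
  rewrite gconjE eQ_coef; congr (_ * _); apply: eq_bigr => l _.
  by rewrite conjgE !invMg !invgK mulgA.
rewrite exchange_big mulr_sumr; apply: eq_bigr => l _.
by rewrite cfIndE // mulrA.
Qed.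

End InducedIdempotent.

(** * The idempotent of a linear character *)

Section LinearEvaluation.

Variables (gT : finGroupType) (H : {group gT}).
Implicit Types (mu : 'CF(H)) (x y : galg gT) (K L : {group gT}).

(** For linear [mu] this is an algebra morphism on [gspan H]. These morphisms separate [K]-invariant
    elements ([lin_eval_inj]), which is how [eQ] is compared with [varepsilon]. *)
Definition lin_eval mu x : algC := \sum_(g in H) ratr (x g : rat) * mu g.

Lemma lin_evalB mu x y : lin_eval mu (x - y) = lin_eval mu x - lin_eval mu y.
Proof.
rewrite /lin_eval -sumrB; apply: eq_bigr => g _.
by rewrite -mulrBl -rmorphB !ffunE.
Qed.

Lemma lin_evalM mu x y : mu \is a linear_char ->
    x \in gspan H -> y \in gspan H ->
  lin_eval mu (x * y) = lin_eval mu x * lin_eval mu y.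
Proof.
move=> lin_mu /gspanP x0 /gspanP y0; rewrite /lin_eval mulr_suml.
under eq_bigr do rewrite ratr_galg_mul mulr_suml.
rewrite exchange_big [LHS](bigID [in H]) /= [X in _ + X]big1 ?addr0 => [|h H'h].
  apply: eq_bigr => h Hh; rewrite mulr_sumr.
  rewrite [RHS](reindex_inj (mulgI h^-1%g)) /=.
  apply: eq_big => [g | g Hg]; first by rewrite groupMl ?groupV.
  by rewrite [RHS]mulrACA -lin_charM // ?mulKVg // groupM ?groupV.
by rewrite big1 // => g _; rewrite x0 // rmorph0 !mul0r.
Qed.

Lemma lin_eval1 mu : mu \is a linear_char -> lin_eval mu 1 = 1.
Proof.
move=> lin_mu; rewrite /lin_eval (bigD1 1%g) //= big1 => [|g /andP[_ neq_g]].
  by rewrite -gelt1 ffunE eqxx rmorph1 mul1r addr0 lin_char1.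
by rewrite -gelt1 ffunE (negPf neq_g) rmorph0 mul0r.
Qed.

Lemma hatE K g : hat K g = (if g \in K then #|K|%:R^-1 else 0) :> rat.
Proof.
rewrite /hat ffunE sum_ffunE; case: ifP => Kg.
  rewrite (bigD1 g) //= big1 => [|h /andP[_ neq_h]].
    by rewrite ffunE eqxx addr0; apply: mulr1.
  by rewrite ffunE eq_sym (negPf neq_h).
rewrite big1 ?scaler0 // => h Kh; rewrite ffunE; case: eqP => // Dg.
by rewrite Dg Kh in Kg.
Qed.

Lemma hat_gspan K : K \subset H -> hat K \in gspan H.
Proof.
by move=> sKH; rewrite memvZ // rpred_sum // => g /(subsetP sKH); apply: gelt_gspan.
Qed.

Lemma gelt_hat K g : g \in K -> gelt g * hat K = hat K.
Proof.
move=> Kg; apply/ffunP=> h; rewrite galg_gelt_mul.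
by rewrite [LHS]hatE [RHS]hatE groupMl ?groupV.
Qed.

Lemma lin_eval_hat mu K : mu \is a linear_char -> K \subset H ->
  lin_eval mu (hat K) = (K \subset cfker mu)%:R.
Proof.
move=> lin_mu sKH; have lin_res := cfRes_lin_char K lin_mu.
transitivity '['Res[K] mu, 1].
  rewrite /lin_eval cfdotE mulr_sumr [LHS](bigID [in K]) /=.
  rewrite [X in _ + X]big1 ?addr0 => [|g /andP[_ K'g]]; last first.
    by rewrite hatE (negPf K'g) rmorph0 mul0r.
  apply: eq_big => [g | g /andP[Hg Kg]].
    by rewrite andb_idl //; apply: subsetP.
  by rewrite hatE Kg fmorphV rmorph_nat cfResE // cfun1E Kg Num.Theory.conjC1 mulr1.
rewrite -{1}(cfIirrE (lin_char_irr lin_res)) -irr0 cfdot_irr -(inj_eq irr_inj).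
rewrite cfIirrE ?lin_char_irr // irr0; congr ((nat_of_bool _)%:R).
apply/eqP/idP=> [res1 | sKmu].
  have := cfker_Res sKH (lin_charW lin_mu).
  by rewrite res1 cfker_cfun1 => /esym/setIidPl.
by rewrite cfRes_sub_ker // lin_char1 // scale1r.
Qed.

Lemma lin_eval_eQ (i j : Iirr H) :
  lin_eval 'chi_j (eQ i) = 'chi_i 1%g * (j \in galois_orbit i)%:R.
Proof.
transitivity ('chi_i 1%g * \sum_(l in galois_orbit i) '['chi_j, 'chi_l]).
  rewrite /lin_eval; under eq_bigr do rewrite eQ_coef -!mulrA.
  rewrite -mulr_sumr; congr (_ * _); under [in RHS]eq_bigr do rewrite cfdotE.
  rewrite -!mulr_sumr exchange_big; congr (_ * _); apply: eq_bigr => g _.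
  rewrite mulr_suml; apply: eq_bigr => l _; rewrite mulrC.
  by rewrite irr_inv.
congr (_ * _); have [Oj | notOj] := boolP (j \in _).
  rewrite (bigD1 j) //= cfdot_irr eqxx big1 ?addr0 // => l /andP[_ /negPf neq_lj].
  by rewrite cfdot_irr eq_sym neq_lj.
rewrite big1 // => l Ol; rewrite cfdot_irr; case: eqP => // Dj.
by rewrite Dj Ol in notOj.
Qed.

End LinearEvaluation.

Section LinearIdempotent.

Variables (gT : finGroupType) (H K : {group gT}) (i : Iirr H).
Hypotheses (lin_i : 'chi_i \is a linear_char) (kerK : cfker 'chi_i = K).

Let nKH : K <| H. Proof. by rewrite -kerK cfker_normal. Qed.
Let sKH : K \subset H. Proof. exact: normal_sub. Qed.
Let der1K : H^`(1)%g \subset K. Proof. by rewrite -kerK lin_char_der1. Qed.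

(** As [H / K] is abelian, the [K]-invariant difference [d] is a class function lifted from [H / K],
    and its coefficients on the linear characters of [H / K] are, up to a factor, evaluations of
    [d]. *)
Lemma lin_eval_inj (x y : galg gT) :
    x \in gspan H -> y \in gspan H ->
    {in K, forall g, gelt g * x = x} -> {in K, forall g, gelt g * y = y} ->
    (forall mu : 'CF(H), mu \is a linear_char -> K \subset cfker mu ->
       lin_eval mu x = lin_eval mu y) ->
  x = y.
Proof.
move=> Hx Hy Kx Ky eq_xy; apply/eqP; rewrite -subr_eq0; set d := x - y.
have /gspanP d0 : d \in gspan H by rewrite memvB.
have Kd g h : g \in K -> d (g * h)%g = d h.
  move=> Kg; have {2}<- : gelt g^-1 * d = d by rewrite mulrBr Kx ?Ky ?groupV.
  by rewrite galg_gelt_mul invgK.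
(* [g ^ h] differs from [g] by a commutator, which lies in [K] by [der1K]. *)
have classd : {in H &, forall g h, ratr (d (g ^ h)%g : rat) = ratr (d g : rat) :> algC}.
  move=> g h Hg Hh; rewrite -[(g ^ h)%g](mulgKV g) Kd //.
  have: [~ h, g^-1]%g \in K by rewrite (subsetP der1K) ?mem_commg ?groupV.
  by rewrite /commg /conjg invgK !mulgA.
have suppd g : g \notin H -> ratr (d g : rat) = 0 :> algC.
  by move=> H'g; rewrite d0 // rmorph0.
have class_d : is_class_fun <<H>>%g [ffun g => ratr (d g : rat) : algC].
  by rewrite genGid; apply: intro_class_fun.
pose phi : 'CF(H) := Cfun 0 class_d.
have phiE g : phi g = ratr (d g : rat) by rewrite cfunElock ffunE.
have Kphi : K \subset cfker phi.
  apply/subsetP=> g Kg; rewrite inE (subsetP sKH) //=.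
  by apply/forallP=> h; rewrite !phiE Kd.
have phi0 : phi = 0.
  rewrite -(cfQuoK nKH Kphi) [(phi / K)%CF]cfun_sum_cfdot big1 ?linear0 // => j _.
  rewrite -(cfMod_iso nKH) cfQuoK //.
  have lin_j : 'chi_j \is a linear_char by apply/char_abelianP/sub_der1_abelian.
  (* The inner product conjugates its second argument, hence the conjugate character. *)
  rewrite cfdotE [X in _ * X](_ : _ = lin_eval ('chi_(conjC_Iirr j) %% K)%CF d).
    rewrite lin_evalB eq_xy ?subrr ?mulr0 ?scale0r ?cfker_mod //.
    by rewrite cfMod_lin_char // conjC_IirrE cfConjC_lin_char.
  apply: eq_bigr => g Hg; rewrite phiE; congr (_ * _).
  by rewrite conjC_IirrE !cfModE // cfunE.
apply/eqP/galg_ratr_inj=> g.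
by rewrite -phiE phi0 cfunE ffunE rmorph0.
Qed.

Lemma lin_char_kerE (mu : 'CF(H)) g : mu \is a linear_char ->
  g \in H -> (g \in cfker mu) = (mu g == 1).
Proof.
by move=> lin_mu Hg; rewrite cfkerEchar ?lin_charW // inE Hg lin_char1.
Qed.

(** Let [x] generate [H] modulo [K]. A linear character with kernel [K] is determined by its value
    at [x], a root of unity whose order depends only on [K]; primitive roots of the same order are
    conjugate under automorphisms of [algC]. *)
Lemma mem_galois_orbit_lin j : cyclic (H / K) -> 'chi_j \is a linear_char ->
  (j \in galois_orbit i) = (cfker 'chi_j == K).
Proof.
move=> /cyclicP[xbar Dxbar] lin_j; apply/idP/eqP=> [/galois_orbitP[u ->] | kerj].
  by rewrite cfker_aut.
have /morphimP[x nKx Hx Dx] : xbar \in (H / K)%g by rewrite Dxbar cycle_id.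
have kerE n : ('chi_i x ^+ n == 1) = ('chi_j x ^+ n == 1).
  have Hn := groupX n Hx; rewrite -!lin_charX //.
  by rewrite -(lin_char_kerE lin_i Hn) -(lin_char_kerE lin_j Hn) kerj kerK.
have prim_order (l : Iirr H) : 'chi_l \is a linear_char ->
    {m | m.-primitive_root ('chi_l x) & (m %| #|H|)%N}.
  move=> lin_l; apply: prim_order_exists => //.
  by rewrite -lin_charX // expg_cardG // lin_char1.
have [m prim_i _] := prim_order i lin_i.
have prim_j : m.-primitive_root ('chi_j x).
  have [m' prim_j _] := prim_order j lin_j; suffices ->: m = m' by [].
  apply/eqP; rewrite eqn_dvd (prim_order_dvd prim_i) (prim_order_dvd prim_j).
  by rewrite kerE (prim_expr_order prim_j) -kerE (prim_expr_order prim_i) !eqxx.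
have [k Dk] : exists k : nat, 'chi_j x = 'chi_i x ^+ k.
  have [|k] := prim_rootP prim_i (_ : 'chi_j x ^+ m = 1).
    by apply/eqP; rewrite -kerE prim_expr_order.
  by exists k.
have [u Du] : {u : {rmorphism algC -> algC} | forall z, z ^+ m = 1 -> u z = z ^+ k}.
  by apply: Qn_aut_exists; rewrite -(prim_root_exp_coprime k prim_i) -Dk.
apply/galois_orbitP; exists u; apply/cfun_inP=> g Hg; rewrite cfunE.
have /cycleP[n Dg] : coset K g \in <[xbar]>%g by rewrite -Dxbar mem_quotient.
have /rcosetP[c Kc ->] : (g \in K :* (x ^+ n))%g.
  apply/rcoset_kercosetP; rewrite ?groupX // ?(subsetP (normal_norm nKH)) //.
  by rewrite Dg morphX ?Dx.
have Hc := subsetP sKH c Kc.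
have lin1 (l : Iirr H) : 'chi_l \is a linear_char -> cfker 'chi_l = K ->
    'chi_l (c * x ^+ n)%g = 'chi_l x ^+ n.
  move=> lin_l kerl; rewrite lin_charM ?groupX // lin_charX //.
  by move: Kc; rewrite -kerl lin_char_kerE // => /eqP->; rewrite mul1r.
by rewrite (lin1 j) // (lin1 i) // rmorphXn /= (Du _ (prim_expr_order prim_i)) Dk.
Qed.

Lemma gelt_hat_diff g (L : {group gT}) : K \subset L -> g \in K ->
  gelt g * (hat K - hat L) = hat K - hat L.
Proof. by move=> sKL Kg; rewrite mulrBr !gelt_hat // (subsetP sKL). Qed.

Lemma gelt_varepsilon g : g \in K -> gelt g * varepsilon H K = varepsilon H K.
Proof.
move=> Kg; rewrite /varepsilon; case: ifP => [_ | /negbT neqHK].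
  exact: gelt_hat.
(* The product needs a factor to absorb [gelt g]; [H] itself is normal and larger than [K], so a
   minimal [L] exists. *)
have [L minL _] : {L : {group gT} | [min L | (L <| H) && (K \proper L)] & L \subset H}.
  apply: mingroup_exists; rewrite normal_refl properEneq sKH andbT.
  by apply: contraNneq neqHK => /val_inj->.
rewrite -big_filter; case Dr: [seq _ <- _ | _] => [|M r].
  have: L \in [seq M : {group gT} <- index_enum _ | [min M | (M <| H) && (K \proper M)]].
    by rewrite mem_filter minL mem_index_enum.
  by rewrite Dr.
have: M \in M :: r by rewrite mem_head.
rewrite -Dr mem_filter => /andP[/mingroupp/andP[_ /proper_sub sKM] _].
by rewrite Dr big_cons mulrA gelt_hat_diff.
Qed.

Lemma varepsilon_gspan : varepsilon H K \in gspan H.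
Proof.
rewrite /varepsilon; case: ifP => _; first exact: hat_gspan.
apply: (big_ind (fun x => x \in gspan H)); last 1 first.
- by move=> L /mingroupp/andP[/normal_sub sLH _]; rewrite memvB ?hat_gspan.
- by rewrite -gelt1 gelt_gspan.
exact: gspanM.
Qed.

(** A factor evaluates to 0 if [L \subset cfker mu] and to 1 otherwise; a kernel larger than [K]
    contains some minimal [L], whose factor vanishes. *)
Lemma lin_eval_varepsilon (mu : 'CF(H)) : mu \is a linear_char ->
  K \subset cfker mu -> lin_eval mu (varepsilon H K) = (cfker mu == K)%:R.
Proof.
move=> lin_mu sKmu; rewrite /varepsilon; case: ifP => [/eqP eqHK | neqHK].
  by rewrite lin_eval_hat // sKmu eqEsubset sKmu -eqHK cfker_sub.
pose over (L : {group gT}) := [min L | (L <| H) && (K \proper L)].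
transitivity (\prod_(L : {group gT} | over L) (1 - (L \subset cfker mu)%:R) : algC).
  apply: proj2 (_ : _ \in gspan H /\ _).
  apply: (big_rec2 (fun x c => x \in gspan H /\ lin_eval mu x = c)).
    by rewrite lin_eval1 // -gelt1 gelt_gspan.
  move=> L c x /mingroupp/andP[/normal_sub sLH _] [Hx <-].
  have Hd : hat K - hat L \in gspan H by rewrite memvB ?hat_gspan.
  by rewrite gspanM // lin_evalM // lin_evalB !lin_eval_hat // sKmu.
have [kerK' | neqK] := eqVneq (cfker mu) K.
  rewrite big1 // => L /mingroupp/andP[_ /proper_subn].
  by rewrite kerK' => /negPf->; rewrite subr0.
have [L minL sL] : {L : {group gT} | [min L | (L <| H) && (K \proper L)]
                                  & L \subset cfker_group mu}.
  by apply: mingroup_exists; rewrite cfker_normal properEneq eq_sym neqK.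
by rewrite (bigD1 L) //= sL subrr mul0r.
Qed.

(** Both sides are fixed by [K], evaluate to 1 at the linear characters with kernel exactly [K], and
    to 0 at the others that are trivial on [K]. *)
Lemma eQ_lin_varepsilon : cyclic (H / K) -> eQ i = varepsilon H K.
Proof.
move=> cycHK; apply: lin_eval_inj; rewrite ?eQ_gspan ?varepsilon_gspan //.
- move=> g Kg; apply/galg_ratr_inj=> h; rewrite galg_gelt_mul !eQ_coef.
  congr (_ * _); apply: eq_bigr => j /galois_orbitP[u ->].
  rewrite invMg invgK !cfunE; congr (u _).
  by rewrite (cfkerMr _ (_ : g \in cfker 'chi_i)) ?kerK.
- exact: gelt_varepsilon.
move=> mu lin_mu sKmu; rewrite lin_eval_varepsilon //.
rewrite -(cfIirrE (lin_char_irr lin_mu)) lin_eval_eQ lin_char1 // mul1r.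
by rewrite mem_galois_orbit_lin // cfIirrE ?lin_char_irr.
Qed.

End LinearIdempotent.

(** * Matrix units along a strong inductive chain *)

Lemma big_mulg (gT : finGroupType) (R : nmodType) (A B : {set gT}) (F : gT -> R) :
    {in setX A B &, injective (fun p => p.1 * p.2)%g} ->
  \sum_(x in (A * B)%g) F x = \sum_(a in A) \sum_(b in B) F (a * b)%g.
Proof.
move=> injAB; rewrite pair_big /=.
have ->: (A * B)%g = [set p.1 * p.2 | p in setX A B]%g.
  apply/setP=> t; apply/mulsgP/imsetP=> [[s a As Ba ->] | [[s a]]].
    by exists (s, a) => //; apply/setXP.
  by case/setXP=> As Ba ->; exists s a.
by rewrite big_imset //=; apply: eq_bigl => p; rewrite inE.
Qed.

Lemma memv_bigcapP (K : fieldType) (vT : vectType K) (I : finType) (P : pred I)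
    (U : I -> {vspace vT}) x :
  reflect (forall i, P i -> x \in U i) (x \in \bigcap_(i | P i) U i)%VS.
Proof.
rewrite (big_morph (fun W : {vspace vT} => x \in W) (id1 := true) (op1 := andb)).
- by rewrite big_andE; apply: forall_inP.
- by move=> V W; rewrite memv_cap.
by rewrite memvf.
Qed.

Section Chain.

Variables (gT : finGroupType) (H : {group gT}) (lambda : 'CF(H)).
Variables (Hc : nat -> {group gT}) (T : nat -> {set gT}) (n : nat).

Local Notation e := (chain_e lambda Hc).
Local Notation V := (chain_V lambda Hc).
Local Notation TT j := (\prod_(i < j) T i)%g.
(* The matrix unit of M_k(F) in row t and column t'. *)
Local Notation E t t' := (gelt t^-1 * e 0 * gelt t').

Lemma chain_e_idem i : e i * e i = e i. Proof. exact: eQ_idem. Qed.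
Lemma chain_e_gspan i : e i \in gspan (Hc i). Proof. exact: eQ_gspan. Qed.
Lemma chain_e_neq0 i : e i != 0. Proof. exact: eQ_neq0. Qed.

Lemma chain_e_comm i g : g \in Hc i -> e i * gelt g = gelt g * e i.
Proof. exact: eQ_central. Qed.

Lemma chain_e_central i x : x \in gspan (Hc i) -> e i * x = x * e i.
Proof. by apply: gspan_comm => g; apply: chain_e_comm. Qed.

Lemma chain_VP i x : reflect (x \in gspan (Hc i) /\ x * e i = x) (x \in V i).
Proof.
apply: (iffP idP) => [|[Hx <-]]; last by rewrite memv_mul ?memv_line.
have sVW : (V i <= gspan (Hc i) :&: fixedSpace (amulr (e i)))%VS.
  apply/prodvP=> y _ Hy /vlineP[c ->]; rewrite -scalerAr memvZ // memv_cap.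
  rewrite gspanM ?chain_e_gspan //=; apply/fixedSpaceP.
  by rewrite lfunE /= -mulrA chain_e_idem.
move/(subvP sVW); rewrite memv_cap => /andP[Hx /fixedSpaceP].
by rewrite lfunE.
Qed.

Lemma chain_V_mulel i x : x \in V i -> e i * x = x.
Proof. by case/chain_VP=> Hx xe; rewrite chain_e_central. Qed.

Lemma chain_e_V i : e i \in V i.
Proof. by apply/chain_VP; rewrite chain_e_gspan chain_e_idem. Qed.

Lemma chain_VM i x y : x \in V i -> y \in V i -> x * y \in V i.
Proof.
move=> /chain_VP[Hx xe] /chain_VP[Hy ye]; apply/chain_VP.
by rewrite gspanM // -mulrA ye.
Qed.

(** From here on the chain enters only through these facts and the properties of [chain_e] above;
    [chain_next] and [chain_orth] later derive the last two from character theory. *)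
Hypothesis sHc : forall i, (i < n)%N -> Hc i \subset Hc i.+1.
Hypothesis sT : forall i, (i < n)%N -> T i \subset Hc i.+1.
Hypothesis T1 : forall i, (i < n)%N -> 1%g \in T i.
Hypothesis e_next : forall i, (i < n)%N ->
  e i.+1 = \sum_(t in T i) gconj (e i) t.
Hypothesis e_orth : forall i t t', (i < n)%N -> t \in T i -> t' \in T i ->
  t != t' -> gconj (e i) t * gconj (e i) t' = 0.

(** Multiplying [e_orth] by [gelt t] on the left and [gelt t'^-1] on the right turns orthogonality
    of conjugates into a delta relation. *)
Lemma chain_e_eTTe i t t' : (i < n)%N -> t \in T i -> t' \in T i ->
  e i * gelt t * gelt t'^-1 * e i = if t == t' then e i else 0.
Proof.
move=> lt_in Tt Tt'; case: eqVneq => [<- | neq_t].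
  by rewrite -(mulrA (e i)) gelt_mulV mulr1 chain_e_idem.
have /(congr1 (fun x => gelt t * x * gelt t'^-1)) := e_orth lt_in Tt Tt' neq_t.
rewrite /gconj mulr0 mul0r !mulrA gelt_mulV mul1r.
by rewrite -[_ * gelt t' * _]mulrA gelt_mulV mulr1.
Qed.

Lemma chain_e_next_absorb i : (i < n)%N -> e i * e i.+1 = e i.
Proof.
move=> lt_in; rewrite e_next // mulr_sumr (bigD1 1%g) ?T1 //= big1 => [|t].
  by rewrite addr0 gconj1 chain_e_idem.
case/andP=> Tt neq_t; rewrite -{1}(gconj1 (e i)); apply: e_orth; rewrite ?T1 //.
by rewrite eq_sym.
Qed.

Lemma chain_sub j : (j <= n)%N -> Hc 0 \subset Hc j.
Proof.
elim: j => // j IHj lt_jn.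
by apply: subset_trans (sHc lt_jn); apply: IHj; apply: ltnW.
Qed.

Lemma chain_e_absorb j : (j <= n)%N -> e 0 * e j = e 0.
Proof.
elim: j => [|j IHj lt_jn]; first by rewrite chain_e_idem.
by rewrite -(IHj (ltnW lt_jn)) -mulrA chain_e_next_absorb.
Qed.

Lemma chain_e0_gspan j : (j <= n)%N -> e 0 \in gspan (Hc j).
Proof. by move/chain_sub/gspanS/subvP; apply; apply: chain_e_gspan. Qed.

Lemma chain_e_absorbl j : (j <= n)%N -> e j * e 0 = e 0.
Proof.
by move=> le_jn; rewrite chain_e_central ?chain_e0_gspan // chain_e_absorb.
Qed.

Lemma TTS j : TT j.+1 = (TT j * T j)%g.
Proof. by rewrite big_ord_recr. Qed.

Lemma TT_sub j : (j <= n)%N -> TT j \subset Hc j.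
Proof.
elim: j => [|j IHj lt_jn]; first by rewrite big_ord0 sub1G.
rewrite TTS mul_subG ?sT //.
by apply: subset_trans (sHc lt_jn); apply: IHj; apply: ltnW.
Qed.

Lemma TT1 j : (j <= n)%N -> 1%g \in TT j.
Proof.
elim: j => [|j IHj lt_jn]; first by rewrite big_ord0 inE.
by rewrite TTS -[1%g]mulg1 mem_mulg ?T1 ?IHj // ltnW.
Qed.

(** [e 0] absorbs [e j], which is central in the group algebra of [Hc j], and [TT j] lies in [Hc j].
    So [e j] can be inserted in front of a transversal element of the next level. *)
Lemma e0_TT_e j s : (j <= n)%N -> s \in TT j ->
  e 0 * gelt s * e j = e 0 * gelt s.
Proof.
move=> le_jn TTs; rewrite -mulrA -chain_e_comm ?(subsetP (TT_sub le_jn)) //.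
by rewrite mulrA chain_e_absorb.
Qed.

Lemma e_TT_e0 j s : (j <= n)%N -> s \in TT j ->
  e j * gelt s^-1 * e 0 = gelt s^-1 * e 0.
Proof.
move=> le_jn TTs; rewrite chain_e_comm ?groupV ?(subsetP (TT_sub le_jn)) //.
by rewrite -mulrA chain_e_absorbl.
Qed.

Lemma e0_TT_split j s s' a a' : (j < n)%N ->
    s \in TT j -> s' \in TT j -> a \in T j -> a' \in T j ->
  e 0 * gelt (s * a) * gelt (s' * a')^-1 * e 0 =
    if a == a' then e 0 * gelt s * gelt s'^-1 * e 0 else 0.
Proof.
move=> lt_jn TTs TTs' Ta Ta'; have le_jn := ltnW lt_jn.
transitivity (e 0 * gelt s * e j * gelt a * gelt a'^-1 * (e j * gelt s'^-1 * e 0)).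
  by rewrite e0_TT_e // e_TT_e0 // invMg !geltM !mulrA.
transitivity (e 0 * gelt s * (e j * gelt a * gelt a'^-1 * e j) * (gelt s'^-1 * e 0)).
  by rewrite !mulrA.
rewrite chain_e_eTTe //; case: eqP => _; last by rewrite mulr0 mul0r.
by rewrite !mulrA e0_TT_e.
Qed.

Lemma e0_TT j t t' : (j <= n)%N -> t \in TT j -> t' \in TT j ->
  e 0 * gelt t * gelt t'^-1 * e 0 = if t == t' then e 0 else 0.
Proof.
elim: j t t' => [|j IHj] t t' le_jn.
  rewrite big_ord0 => /set1P-> /set1P->.
  by rewrite eqxx -(mulrA (e 0)) gelt_mulV mulr1 chain_e_idem.
rewrite TTS => /mulsgP[s a TTs Ta Dt] /mulsgP[s' a' TTs' Ta' Dt'].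
have [<- | neq_t] := eqVneq t t'.
  by rewrite -(mulrA (e 0)) gelt_mulV mulr1 chain_e_idem.
rewrite Dt Dt' (e0_TT_split le_jn) //; case: (a =P a') => // eq_a.
rewrite IHj // 1?ltnW //; case: (s =P s') => // eq_s.
by rewrite Dt Dt' eq_a eq_s eqxx in neq_t.
Qed.

(** Unique factorization comes from the algebra: for equal products the left side of [e0_TT_split]
    is [e 0], which is nonzero, so [a = a']. *)
Lemma TT_mul_inj j : (j < n)%N ->
  {in setX (TT j) (T j) &, injective (fun p => p.1 * p.2)%g}.
Proof.
move=> lt_jn [s a] [s' a'] /setXP[TTs Ta] /setXP[TTs' Ta'] /= eq_sa.
have := e0_TT_split lt_jn TTs TTs' Ta Ta'.
rewrite eq_sa -(mulrA (e 0)) gelt_mulV mulr1 chain_e_idem.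
case: eqP => [eq_a _ | _ /eqP]; last by rewrite (negPf (chain_e_neq0 0)).
by move: eq_sa; rewrite eq_a => /mulIg->.
Qed.

Lemma big_TTS j (F : gT -> galg gT) : (j < n)%N ->
  \sum_(t in TT j.+1) F t = \sum_(s in TT j) \sum_(a in T j) F (s * a)%g.
Proof. by move=> lt_jn; rewrite TTS big_mulg //; apply: TT_mul_inj. Qed.

Lemma sum_gconj_TTS j x : (j < n)%N ->
  \sum_(t in TT j.+1) gconj x t =
    \sum_(a in T j) gconj (\sum_(s in TT j) gconj x s) a.
Proof.
move=> lt_jn; rewrite big_TTS // exchange_big; apply: eq_bigr => a _.
rewrite /gconj mulr_sumr mulr_suml; apply: eq_bigr => s _.
exact: gconjM.
Qed.

Lemma sum_gconj_e0 j : (j <= n)%N -> \sum_(t in TT j) gconj (e 0) t = e j.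
Proof.
elim: j => [|j IHj] lt_jn; first by rewrite big_ord0 big_set1 gconj1.
by rewrite sum_gconj_TTS // IHj 1?ltnW // e_next.
Qed.

(** Peirce decomposition for the orthogonal idempotents [gconj (e 0) t], whose sum is [e j]. *)
Lemma TT_expand j x : (j <= n)%N -> e j * x * e j = x ->
  x = \sum_(t in TT j) \sum_(t' in TT j)
        gelt t^-1 * (e 0 * gelt t * x * gelt t'^-1 * e 0) * gelt t'.
Proof.
move=> le_jn {1}<-; rewrite -(sum_gconj_e0 le_jn) !mulr_suml.
apply: eq_bigr => t _; rewrite mulr_sumr; apply: eq_bigr => t' _.
by rewrite /gconj !mulrA.
Qed.

Lemma T_expand j x : (j < n)%N -> e j.+1 * x * e j.+1 = x ->
  x = \sum_(t in T j) \sum_(t' in T j)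
        gelt t^-1 * (e j * gelt t * x * gelt t'^-1 * e j) * gelt t'.
Proof.
move=> lt_jn {1}<-; rewrite e_next // !mulr_suml.
apply: eq_bigr => t _; rewrite mulr_sumr; apply: eq_bigr => t' _.
by rewrite /gconj !mulrA.
Qed.

Lemma theta_inj j : (j < n)%N -> {in V j.+1 &, injective (theta lambda Hc T j)}.
Proof.
move=> lt_jn x y Vx Vy eq_xy.
have eV z : z \in V j.+1 -> e j.+1 * z * e j.+1 = z.
  by move=> Vz; rewrite chain_V_mulel //; case/chain_VP: Vz.
rewrite (T_expand lt_jn (eV x Vx)) (T_expand lt_jn (eV y Vy)).
apply: eq_bigr => t Tt; apply: eq_bigr => t' Tt'.
by rewrite -!(@thetaE _ _ lambda Hc T) // eq_xy.
Qed.

Lemma sum_gconj_T_V j y : (j < n)%N -> y \in V j ->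
  \sum_(a in T j) gconj y a \in V j.+1.
Proof.
move=> lt_jn /chain_VP[Hy ye]; apply/chain_VP; split.
  apply: rpred_sum => a Ta; have Ha := subsetP (sT lt_jn) a Ta.
  by rewrite gconj_gspan // (subvP (gspanS (sHc lt_jn))).
rewrite mulr_suml; apply: eq_bigr => a Ta.
rewrite -{1}ye gconj_mul e_next // -mulrA mulr_sumr (bigD1 a) //= big1 => [|b].
  by rewrite addr0 -!gconj_mul chain_e_idem ye.
by case/andP=> Tb neq_b; rewrite e_orth // eq_sym.
Qed.

(** [theta_inv] is specified only on the image of [theta], so the sum of conjugates is first shown
    to be mapped to the scalar block; [theta_inj] then identifies the two elements. *)
Lemma theta_inv_scalar j y : (j < n)%N -> y \in V j ->
  theta_inv lambda Hc T j (scalar_block T j y) = \sum_(a in T j) gconj y a.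
Proof.
move=> lt_jn Vy; set z := \sum_(a in T j) _.
have Vz : z \in V j.+1 by apply: sum_gconj_T_V.
have ey : e j * y * e j = y by rewrite chain_V_mulel //; case/chain_VP: Vy.
have Dz : theta lambda Hc T j z = scalar_block T j y.
  apply/ffunP=> -[t t']; rewrite [RHS]ffunE /=.
  have [Tt | T't] := boolP (t \in T j); last first.
    by rewrite lfunE ffunE /= (negPf T't).
  have [Tt' | T't'] := boolP (t' \in T j); last first.
    rewrite lfunE ffunE /= (negPf T't') andbF.
    by case: eqP => // Dt; rewrite Dt (negPf T't') in Tt.
  rewrite thetaE // /z [_ * gelt t * _]mulr_sumr [_ * gelt t'^-1]mulr_suml.
  rewrite [_ * e j]mulr_suml (bigD1 t) //= big1 => [|a /andP[Ta neq_a]].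
    rewrite addr0; transitivity
      (e j * gelt t * gelt t^-1 * e j * y * (e j * gelt t * gelt t'^-1 * e j)).
      by rewrite /gconj -[in LHS]ey !mulrA.
    rewrite !chain_e_eTTe // eqxx; case: eqP => _; first by rewrite ey.
    by rewrite mulr0.
  transitivity (e j * gelt t * gelt a^-1 * e j * y * (e j * gelt a * gelt t'^-1 * e j)).
    by rewrite /gconj -[in LHS]ey !mulrA.
  by rewrite chain_e_eTTe // eq_sym (negPf neq_a) !mul0r.
have [Vm Dm] := theta_invK (memv_img (theta lambda Hc T j) Vz).
by rewrite -Dz; apply: (theta_inj lt_jn).
Qed.

Lemma nested_diagE j b : (j <= n)%N -> b \in V 0 ->
  nested_diag lambda Hc T j b \in V j /\
  nested_diag lambda Hc T j b = \sum_(t in TT j) gconj b t.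
Proof.
move=> + Vb; elim: j => [_ | j IHj lt_jn].
  by rewrite big_ord0 big_set1 gconj1 id_lfunE.
have [Vd Dd] := IHj (ltnW lt_jn).
have ->: nested_diag lambda Hc T j.+1 b =
    theta_inv lambda Hc T j (scalar_block T j (nested_diag lambda Hc T j b)).
  by rewrite [LHS]comp_lfunE; congr (theta_inv _ _ _ _ _); rewrite comp_lfunE lfunE.
rewrite theta_inv_scalar //.
by rewrite sum_gconj_T_V // Dd -sum_gconj_TTS.
Qed.

(** Flattens the nested blocks into one matrix indexed by [TT j]: by absorption of [e j], the block
    at [s], [s'] of the block at [a], [a'] is the block at [s * a], [s' * a']. *)
Lemma nested_matricesP j (S : {vspace galg gT}) x : (j <= n)%N -> (S <= V 0)%VS ->
  reflect (x \in V j /\ {in TT j &, forall t t',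
             e 0 * gelt t * x * gelt t'^-1 * e 0 \in S})
          (x \in nested_matrices lambda Hc T S j).
Proof.
move=> le_jn /subvP sSV; elim: j x le_jn => [|j IHj] x le_jn /=.
  have Dx : x \in V 0 -> e 0 * gelt 1 * x * gelt 1^-1 * e 0 = x.
    move=> Vx; rewrite gelt1 mulr1 chain_V_mulel // invg1 gelt1 mulr1.
    by case/chain_VP: Vx.
  apply: (iffP idP) => [Sx | [Vx]]; rewrite big_ord0.
    have Vx := sSV x Sx; split=> // t t' /set1P-> /set1P->.
    by rewrite Dx.
  by move/(_ 1%g 1%g (set11 _) (set11 _)); rewrite Dx.
have entryE t t' : t \in T j -> t' \in T j ->
    (linfun (entry (t, t')) \o theta lambda Hc T j)%VF x =
      e j * gelt t * x * gelt t'^-1 * e j.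
  by move=> Tt Tt'; rewrite comp_lfunE [LHS]lfunE; apply: thetaE.
have le_j := ltnW le_jn.
have splitE s a s' a' : s \in TT j -> s' \in TT j ->
    e 0 * gelt (s * a) * x * gelt (s' * a')^-1 * e 0 =
    e 0 * gelt s * (e j * gelt a * x * gelt a'^-1 * e j) * gelt s'^-1 * e 0.
  move=> TTs TTs'; transitivity
    (e 0 * gelt s * e j * gelt a * x * gelt a'^-1 * (e j * gelt s'^-1 * e 0)).
    by rewrite e0_TT_e // e_TT_e0 // invMg !geltM !mulrA.
  by rewrite !mulrA.
rewrite memv_cap; apply: (iffP andP) => [[Vx /memv_bigcapP Sx] | [Vx Sx]].
  split=> // t t'.
  rewrite TTS => /mulsgP[s a TTs Ta ->] /mulsgP[s' a' TTs' Ta' ->].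
  rewrite splitE //.
  have := Sx (a, a'); rewrite inE Ta Ta' -memv_preim entryE //.
  by case/(_ isT)/(IHj _ le_j)=> _; apply.
split=> //; apply/memv_bigcapP=> -[a a'] /setXP[Ta Ta'].
rewrite -memv_preim entryE //; apply/(IHj _ le_j).
set y := e j * gelt a * x * gelt a'^-1 * e j.
have Sy s s' : s \in TT j -> s' \in TT j ->
    e 0 * gelt s * y * gelt s'^-1 * e 0 \in S.
  by move=> TTs TTs'; rewrite -splitE // Sx // TTS mem_mulg.
have ye : y * e j = y by rewrite -mulrA chain_e_idem.
split; last exact: Sy; apply/chain_VP; split=> //.
(* A priori [y] lies only in the group algebra of [Hc j.+1]. Its Peirce blocks lie in [S], hence in
   [gspan (Hc 0)], which puts [y] in [gspan (Hc j)]. *)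
rewrite (@TT_expand j y le_j); last by rewrite -mulrA ye /y !mulrA chain_e_idem.
apply: rpred_sum => s TTs; apply: rpred_sum => s' TTs'.
have /chain_VP[H0 _] := sSV _ (Sy s s' TTs TTs').
have sub := subsetP (TT_sub le_j).
apply: gspanM; last by rewrite gelt_gspan ?sub.
apply: gspanM; first by rewrite gelt_gspan ?groupV ?sub.
exact: subvP (gspanS (chain_sub le_j)) _ H0.
Qed.

Lemma mxunit_mul t t' s s' : t' \in TT n -> s \in TT n ->
  E t t' * E s s' = if t' == s then E t s' else 0.
Proof.
move=> TTt' TTs; transitivity (gelt t^-1 * (e 0 * gelt t' * gelt s^-1 * e 0) * gelt s').
  by rewrite !mulrA.
by rewrite (e0_TT (leqnn n)) //; case: eqP => _; rewrite // mulr0 mul0r.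
Qed.

Lemma mxunit_V t t' : t \in TT n -> t' \in TT n -> E t t' \in V n.
Proof.
move=> TTt TTt'; have sub := subsetP (TT_sub (leqnn n)).
apply/chain_VP; split; first by rewrite !gspanM ?gelt_gspan ?groupV ?sub ?chain_e0_gspan.
by rewrite -!(mulrA (gelt t^-1)) e0_TT_e.
Qed.

(** The sum is diag(b,...,b), and the product is the matrix with [b] in position [(t, t')]. With the
    next lemma, diag(b,...,b) commutes with the matrix units. *)
Lemma sum_gconj_mul_mxunit b t t' : t \in TT n -> b * e 0 = b ->
  (\sum_(s in TT n) gconj b s) * E t t' = gelt t^-1 * b * gelt t'.
Proof.
move=> TTt be; rewrite [LHS]mulr_suml (bigD1 t) //= big1 => [|s /andP[TTs neq_s]].
  rewrite addr0 /gconj !mulrA -[_ * gelt t * _]mulrA gelt_mulV mulr1.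
  by rewrite -[_ * b * e 0]mulrA be.
transitivity (gelt s^-1 * b * (e 0 * gelt s * gelt t^-1 * e 0) * gelt t').
  by rewrite /gconj -[in LHS]be !mulrA.
by rewrite (e0_TT (leqnn n)) // (negPf neq_s) mulr0 mul0r.
Qed.

Lemma mxunit_mul_sum_gconj b t t' : t' \in TT n -> e 0 * b = b ->
  E t t' * (\sum_(s in TT n) gconj b s) = gelt t^-1 * b * gelt t'.
Proof.
move=> TTt' eb; rewrite [LHS]mulr_sumr (bigD1 t') //= big1 => [|s /andP[TTs neq_s]].
  rewrite addr0 /gconj !mulrA -[_ * gelt t' * _]mulrA gelt_mulV mulr1.
  by rewrite -(mulrA _ (e 0) b) eb.
transitivity (gelt t^-1 * (e 0 * gelt t' * gelt s^-1 * e 0) * b * gelt s).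
  by rewrite /gconj -[in LHS]eb !mulrA.
by rewrite (e0_TT (leqnn n)) // eq_sym (negPf neq_s) mulr0 !mul0r.
Qed.

Lemma sum_mxunit : \sum_(t in TT n) E t t = e n.
Proof. exact: sum_gconj_e0. Qed.

(** * The matrix algebra [alg_B] and its centralizer *)

Local Notation EE := (diag_E lambda Hc T n).
Local Notation FF := (center_F lambda Hc n).
Local Notation Cen := (cent_B lambda Hc T n).

Lemma center_FP x : reflect (x \in V n /\ {in V n, forall y, x * y = y * x}) (x \in FF).
Proof.
by rewrite memv_cap; apply: (iffP andP) => -[Vx /centvP cx].
Qed.

Lemma base_FP b : reflect (b \in V 0 /\ \sum_(t in TT n) gconj b t \in FF)
  (b \in base_F lambda Hc T n).
Proof.
rewrite /base_F memv_cap -memv_preim; apply: (iffP andP) => -[Vb Fb]; split=> //.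
  by have [_ <-] := nested_diagE (leqnn n) Vb.
by have [_ ->] := nested_diagE (leqnn n) Vb.
Qed.

Lemma chain_e_FF : e n \in FF.
Proof.
apply/center_FP; split=> [|y Vy]; first exact: chain_e_V.
by rewrite chain_V_mulel //; case/chain_VP: Vy.
Qed.

Lemma base_F_e0 : e 0 \in base_F lambda Hc T n.
Proof.
by apply/base_FP; rewrite chain_e_V sum_gconj_e0 ?leqnn ?chain_e_FF.
Qed.

(** The blocks are [e 0] or 0, and [e 0] is in [base_F] because diag(e 0,...,e 0) is the identity
    [e n]. *)
Lemma mxunit_B t t' : t \in TT n -> t' \in TT n -> E t t' \in alg_B lambda Hc T n.
Proof.
move=> TTt TTt'; apply/nested_matricesP; rewrite ?capvSl ?leqnn //.
split=> [|s s' TTs TTs']; first exact: mxunit_V.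
have ->: e 0 * gelt s * E t t' * gelt s'^-1 * e 0 =
    (e 0 * gelt s * gelt t^-1 * e 0) * (gelt t' * gelt s'^-1 * e 0).
  by rewrite !mulrA.
rewrite (e0_TT (leqnn n)) //; case: eqP => _; last by rewrite mul0r mem0v.
by rewrite !mulrA (e0_TT (leqnn n)) //; case: eqP => _; rewrite ?mem0v ?base_F_e0.
Qed.

(** An element of [alg_B] combines matrix units with coefficients diag(b,...,b), [b] in [base_F].
    These are central, so only the matrix units have to be tested. *)
Lemma cent_BP c : reflect
  (c \in V n /\ {in TT n &, forall t t', c * E t t' = E t t' * c}) (c \in Cen).
Proof.
rewrite memv_cap; apply: (iffP andP) => -[Vc cE]; split=> //.
  by move=> t t' TTt TTt'; apply: (centvP cE); apply: mxunit_B.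
apply/centvP=> x /nested_matricesP[]; rewrite ?capvSl ?leqnn // => Vx Fx.
have exe : e n * x * e n = x by rewrite chain_V_mulel //; case/chain_VP: Vx.
rewrite (TT_expand (leqnn n) exe) [c * _]mulr_sumr [_ * c]mulr_suml.
apply: eq_bigr => t TTt.
rewrite [c * _]mulr_sumr [_ * c]mulr_suml; apply: eq_bigr => t' TTt'.
move: (Fx t t' TTt TTt'); move: (_ * e 0) => b /base_FP[Vb /center_FP[_ Db]].
rewrite -sum_gconj_mul_mxunit //; last by case/chain_VP: Vb.
by rewrite mulrA -Db // -mulrA cE // mulrA.
Qed.

(** The coefficients are diag(b,...,b) for the Peirce blocks [b] of [x]. This will bound the
    dimension of the component by that of [Cen]. *)
Lemma chain_V_span x : x \in V n ->
  exists2 c : gT -> gT -> galg gT,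
      forall t t', t \in TT n -> t' \in TT n -> c t t' \in Cen
    & x = \sum_(t in TT n) \sum_(t' in TT n) c t t' * E t t'.
Proof.
move=> Vx; have exe : e n * x * e n = x by rewrite chain_V_mulel //; case/chain_VP: Vx.
pose b t t' := e 0 * gelt t * x * gelt t'^-1 * e 0.
have be t t' : b t t' * e 0 = b t t' by rewrite -mulrA chain_e_idem.
have eb t t' : e 0 * b t t' = b t t' by rewrite !mulrA chain_e_idem.
have sub := subsetP (TT_sub (leqnn n)); have /chain_VP[Hx _] := Vx.
exists (fun t t' => \sum_(s in TT n) gconj (b t t') s) => [t t' TTt TTt' | ].
  apply/cent_BP; split=> [|r r' TTr TTr']; last first.
    by rewrite sum_gconj_mul_mxunit // mxunit_mul_sum_gconj.
  apply/chain_VP; split; last first.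
    rewrite -{1}sum_mxunit [LHS]mulr_sumr; apply: eq_bigr => s TTs.
    by rewrite sum_gconj_mul_mxunit.
  have Hb : b t t' \in gspan (Hc n).
    by rewrite !gspanM ?gelt_gspan ?groupV ?sub ?chain_e0_gspan.
  by apply: rpred_sum => s TTs; rewrite gconj_gspan ?sub.
rewrite {1}(TT_expand (leqnn n) exe); apply: eq_bigr => t TTt.
by apply: eq_bigr => t' TTt'; rewrite sum_gconj_mul_mxunit.
Qed.

Lemma cent_e0 c : c \in Cen -> c * e 0 = e 0 * c.
Proof.
case/cent_BP=> _ cE; have := cE 1%g 1%g; rewrite invg1 gelt1 mul1r mulr1.
by apply; apply: TT1.
Qed.

(** [c] need not commute with [gelt t^-1], but once a copy of [e 0] is moved across [c] the left
    factor becomes [E t 1], which it does commute with. *)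
Lemma cent_mul_mxunit c t t' : t \in TT n -> t' \in TT n -> c \in Cen ->
  gelt t^-1 * c * e 0 * gelt t' = c * E t t'.
Proof.
move=> TTt TTt' Cc; have ce := cent_e0 Cc; have /cent_BP[_ cE] := Cc.
have TT1n : 1%g \in TT n by rewrite TT1.
transitivity (E t 1%g * c * e 0 * gelt t').
  rewrite gelt1 mulr1 -[_ * e 0 * c]mulrA -ce !mulrA -(mulrA _ (e 0) (e 0)).
  by rewrite chain_e_idem.
rewrite -cE // gelt1 mulr1 -!mulrA; congr (_ * (_ * _)).
by rewrite mulrA chain_e_idem.
Qed.

Lemma cent_identity c : c \in Cen -> e n * c = c /\ c * e n = c.
Proof. by case/cent_BP=> Vc _; rewrite chain_V_mulel //; case/chain_VP: Vc. Qed.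

Lemma cent_B_mul c d : c \in Cen -> d \in Cen -> c * d \in Cen.
Proof.
move=> /cent_BP[Vc cE] /cent_BP[Vd dE]; apply/cent_BP; split; first exact: chain_VM.
by move=> t t' TTt TTt'; rewrite -mulrA dE // mulrA cE // mulrA.
Qed.

Section MatrixUnits.

Variables (I : finType) (c : I -> I -> galg gT).
Hypothesis cC : forall i j, c i j \in Cen.
Hypothesis c_mul : forall i j r l, c i j * c r l = if j == r then c i l else 0.
Hypothesis c_sum : \sum_i c i i = e n.

Let u (p q : gT * I) := c p.2 q.2 * E p.1 q.1.

Lemma tensor_mxunit_V p q : p.1 \in TT n -> q.1 \in TT n -> u p q \in V n.
Proof.
by move=> TTp TTq; apply: chain_VM; [case/cent_BP: (cC p.2 q.2) | apply: mxunit_V].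
Qed.

Lemma tensor_mxunit_mul p q r s :
    p.1 \in TT n -> q.1 \in TT n -> r.1 \in TT n -> s.1 \in TT n ->
  u p q * u r s = if q == r then u p s else 0.
Proof.
case: p q r s => [t i] [t' i'] [r j] [r' j'] /= TTt TTt' TTr TTr'; rewrite /u /=.
have /cent_BP[_ cE] := cC j j'.
transitivity (c i i' * c j j' * (E t t' * E r r')).
  rewrite -[LHS]mulrA -[RHS]mulrA; congr (_ * _).
  by rewrite [LHS]mulrA -cE // -[LHS]mulrA.
rewrite c_mul mxunit_mul // xpair_eqE andbC.
by case: eqP => _; case: eqP => _; rewrite ?mulr0 ?mul0r.
Qed.

Lemma tensor_mxunit_sum : \sum_(p in setX (TT n) [set: I]) u p p = e n.
Proof.
transitivity (\sum_(t in TT n) \sum_(i : I) c i i * E t t).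
  by rewrite pair_big /=; apply: eq_bigl => p; rewrite !inE andbT.
rewrite -[RHS]chain_e_idem -{1}c_sum -{1}sum_mxunit mulr_suml exchange_big.
by apply: eq_bigr => i _; rewrite mulr_sumr.
Qed.

End MatrixUnits.

End Chain.

(** * Irreducibility along the chain *)

Section InverseOfZero.

Import VectorInternalTheory.

(** The inverse is a pseudo-inverse, with value 0 at 0; [theta_inv0] relies on this. *)
Lemma inv_lfun0 (K : fieldType) (aT rT : vectType K) : (0 : 'Hom(aT, rT))^-1%VF = 0.
Proof.
have Hom0 (U W : vectType K) : (0 : 'Hom(U, W)) = Hom 0.
  by apply/lfunP=> x; rewrite zero_lfunE unlock /= mulmx0 linear0.
rewrite Hom0 [RHS]Hom0 /inv_lfun; congr Hom.
by rewrite /pinvmx mxrank0 pid_mx_0 mulmx0 mul0mx.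
Qed.

End InverseOfZero.

Lemma cfIirr_notin_irr (gT : finGroupType) (X : {group gT}) (phi : 'CF(X)) :
  phi \notin irr X -> cfIirr phi = 0.
Proof.
rewrite -index_mem size_tuple => /negPf not_irr; apply: val_inj.
by rewrite /cfIirr locked_withE val_insubd not_irr.
Qed.

Section TrivialIdempotent.

Variables (gT : finGroupType) (X Y : {group gT}).

Lemma gelt_eQ0 g : g \in Y -> gelt g * eQ (0 : Iirr Y) = eQ (0 : Iirr Y).
Proof.
move=> Yg; apply/galg_ratr_inj=> h; rewrite galg_gelt_mul !eQ_coef.
congr (_ * _); rewrite galois_orbit0 !big_set1 irr0 !cfun1E.
by rewrite !groupV groupMl ?groupV.
Qed.

(** Group elements act trivially on [eQ 0], so the product is [eQ 0] times the sum of the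
    coefficients of [eQ i]; this sum is the evaluation at the trivial character, which is not in the
    orbit of [i]. *)
Lemma eQ_mul_eQ0 (i : Iirr X) : X \subset Y -> i != 0 ->
  eQ i * eQ (0 : Iirr Y) = 0.
Proof.
move=> sXY nz_i; rewrite {1}(gspan_sum (eQ_gspan i)) mulr_suml.
transitivity ((\sum_(g in X) (eQ i g : rat)) *: eQ (0 : Iirr Y)).
  rewrite scaler_suml; apply: eq_bigr => g Xg.
  by rewrite -scalerAl gelt_eQ0 ?(subsetP sXY).
suffices ->: \sum_(g in X) (eQ i g : rat) = 0 by rewrite scale0r.
apply: (fmorph_inj (ratr : {rmorphism rat -> algC})).
rewrite rmorph0 rmorph_sum.
transitivity (lin_eval 'chi_(0 : Iirr X) (eQ i)).
  by apply: eq_bigr => g Xg; rewrite irr0 cfun1E Xg mulr1.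
rewrite lin_eval_eQ; case: galois_orbitP => [[u] | _]; last exact: mulr0.
rewrite -aut_IirrE => /irr_inj/esym/eqP; rewrite aut_Iirr_eq0.
by rewrite (negPf nz_i).
Qed.

End TrivialIdempotent.

(** * Transversals of the stabilizer of an element *)

Section Stabilizer.

Variables (gT : finGroupType) (Y : {group gT}) (a : galg gT).

Lemma gcent_group_set : group_set (gcent Y a).
Proof.
apply/group_setP; split=> [|g h]; first by rewrite inE group1 gconj1 eqxx.
rewrite !inE => /andP[Yg /eqP ag] /andP[Yh /eqP ah].
by rewrite groupM //= gconjM ag ah eqxx.
Qed.
Canonical gcent_group := Group gcent_group_set.

Variable T : {set gT}.
Hypothesis trT : is_transversal T (rcosets (gcent Y a) Y) Y.

Let C : {group gT} := gcent_group.

Let sCY : C \subset Y. Proof. by apply/subsetP=> g; rewrite inE => /andP[]. Qed.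
Let sTY : T \subset Y. Proof. exact: transversal_sub trT. Qed.

Let meet1 y : y \in Y -> exists t, T :&: C :* y = [set t].
Proof.
case/and3P: trT => _ _ /forall_inP meet1 Yy; apply/cards1P/meet1.
by apply/rcosetsP; exists y.
Qed.

Lemma transversal_inj t t' : t \in T -> t' \in T ->
  gconj a t = gconj a t' -> t = t'.
Proof.
move=> Tt Tt' eq_a; have [Yt Yt'] := (subsetP sTY t Tt, subsetP sTY t' Tt').
have Ct : (t \in C :* t')%g.
  by rewrite mem_rcoset inE groupM ?groupV //= gconjM eq_a -gconjM mulgV gconj1.
have [s Ds] := meet1 Yt'.
have: t \in T :&: C :* t' by rewrite inE Tt.
have: t' \in T :&: C :* t' by rewrite inE Tt' rcoset_refl.
by rewrite Ds => /set1P-> /set1P->.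
Qed.

Lemma sum_gconj_transversal :
  \sum_(y in Y) gconj a y = (\sum_(t in T) gconj a t) *+ #|C|.
Proof.
have injCT : {in setX C T &, injective (fun p => p.1 * p.2)%g}.
  move=> [c t] [c' t'] /setXP[/setIdP[_ /eqP ac] Tt].
  move=> /setXP[/setIdP[_ /eqP ac'] Tt'] /= eq_ct.
  have eq_t : t = t'.
    apply: transversal_inj => //; move/(congr1 (gconj a)): eq_ct.
    by rewrite !gconjM ac ac'.
  by move: eq_ct; rewrite eq_t => /mulIg->.
have ->: Y = (C * T)%g :> {set gT}.
  apply/eqP; rewrite eqEsubset mul_subG // andbT; apply/subsetP=> y Yy.
  have [t Dt] := meet1 Yy; have: t \in T :&: C :* y by rewrite Dt set11.
  rewrite inE rcoset_sym => /andP[Tt /rcosetP[c Cc ->]].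
  by rewrite mem_mulg.
rewrite big_mulg // -sumr_const; apply: eq_bigr => c /setIdP[_ /eqP ac].
by apply: eq_bigr => t _; rewrite gconjM ac.
Qed.

End Stabilizer.

Section ChainHypotheses.

Variables (gT : finGroupType) (G H K : {group gT}) (lambda : 'CF(H)) (n : nat).
Variables (Hc : nat -> {group gT}) (T : nat -> {set gT}).
Hypothesis pairHK : shoda_pair G H K.
Hypotheses (lin_lambda : lambda \is a linear_char) (ker_lambda : cfker lambda = K).
Hypothesis chainHc : strong_inductive_chain lambda Hc G n.
Hypothesis trT : forall i, (i < n)%N ->
  is_transversal (T i) (rcosets (chain_C lambda Hc i) (Hc i.+1)) (Hc i.+1)
  /\ 1%g \in T i.
Hypothesis nzEE : diag_E lambda Hc T n != 0%VS.

Local Notation e := (chain_e lambda Hc).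
Local Notation V := (chain_V lambda Hc).

Let Hc0 : Hc 0 = H. Proof. by case: chainHc. Qed.
Let Hcn : Hc n = G. Proof. by case: chainHc. Qed.
Lemma chain_subS i : (i < n)%N -> Hc i \subset Hc i.+1.
Proof. by case: chainHc => _ _ hc /hc[]. Qed.

Let sHHc i : (i <= n)%N -> H \subset Hc i.
Proof. by move=> le_in; rewrite -Hc0; apply: (chain_sub chain_subS). Qed.

Let sHcG i : (i <= n)%N -> Hc i \subset G.
Proof.
move=> le_in; rewrite -Hcn -(subnK le_in) addnC.
have: (i + (n - i) <= n)%N by rewrite subnKC.
elim: (n - i)%N => [|k IHk] le_n; first by rewrite addn0.
by rewrite addnS in le_n *; apply: subset_trans (chain_subS le_n); apply/IHk/ltnW.
Qed.

(** Then [theta_inv i] would be the pseudo-inverse of 0, hence 0, and so would every [nested_diag]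
    beyond level [i], against [nzEE]. *)
Let theta_inv0 i : (i < n)%N -> {in V i.+1, forall x, theta lambda Hc T i x = 0} ->
  False.
Proof.
move=> lt_in theta0; have inv0 : theta_inv lambda Hc T i = 0.
  rewrite /theta_inv (_ : theta lambda Hc T i \o projv (V i.+1) = 0)%VF.
    by rewrite inv_lfun0 comp_lfun0r.
  by apply/lfunP=> x; rewrite [LHS]comp_lfunE [RHS]zero_lfunE theta0 ?memv_proj.
have diag0 j : (i < j)%N -> nested_diag lambda Hc T j = 0.
  elim: j => // j IHj; rewrite ltnS leq_eqVlt /= => /predU1P[<- | /IHj->].
    by rewrite inv0 comp_lfun0l.
  by rewrite !comp_lfun0r.
by move: nzEE; rewrite /diag_E diag0 // lim0g eqxx.
Qed.

(* With [~: [set g], H] a generated subgroup, a Shoda pair does not make the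
   induced characters irreducible: if one were not, [cfIirr] would
   return the index of the trivial character, hence the corresponding [theta]
   and therefore the whole of [diag_E] would vanish. *)
Lemma chain_irr i : (i <= n)%N -> 'Ind[Hc i] lambda \in irr (Hc i).
Proof.
elim: i => [_ | i IHi lt_in]; first by rewrite Hc0 cfInd_id lin_char_irr.
have irr_i := IHi (ltnW lt_in); apply/idPn=> not_irr.
have De1 : e i.+1 = eQ (0 : Iirr (Hc i.+1)) by rewrite /chain_e /ind_idem cfIirr_notin_irr.
(* If the character at level [i] is trivial, [eQ_mul_eQ0] does not apply. Comparing degrees then
   gives [Hc i = H] and [K = H], so the Shoda condition forces [G = H] and the chain stays at [H],
   where [lambda] is irreducible. *)
have [j0 | nz_j] := eqVneq (cfIirr ('Ind[Hc i] lambda)) 0.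
  have triv : 'Ind[Hc i] lambda = 1 by rewrite -(cfIirrE irr_i) j0 irr0.
  have sHi := sHHc (ltnW lt_in).
  have idx : #|Hc i : H| = 1%N.
    have := cfInd1 lambda sHi; rewrite triv cfun11 lin_char1 // mulr1.
    by move/esym/eqP; rewrite Num.Theory.pnatr_eq1 => /eqP.
  have eqHi : Hc i = H by apply/val_inj/eqP; rewrite eqEsubset sHi -indexg_eq1 idx eqxx.
  have lambda1 : lambda = 1 by move: triv; rewrite eqHi cfInd_id.
  have eqHK : K = H by apply: val_inj; rewrite /= -ker_lambda lambda1 cfker_cfun1.
  have sGH : G \subset H.
    by apply/subsetP=> g Gg; case: pairHK => _ _ _; apply; rewrite // eqHK subsetIr.
  have eqHi1 : Hc i.+1 = H.
    by apply/val_inj/eqP; rewrite eqEsubset sHHc // (subset_trans (sHcG lt_in)).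
  by rewrite eqHi1 cfInd_id lin_char_irr in not_irr.
apply: (theta_inv0 lt_in) => x Vx; apply/ffunP=> -[t t'].
rewrite lfunE ffunE [RHS]ffunE /=; case: ifP => // /andP[Tt _].
have Ht : t \in Hc i.+1.
  by case: (trT lt_in) => /transversal_sub/subsetP/(_ t Tt).
rewrite -(chain_V_mulel Vx) De1 -(mulrA (e i)) (mulrA (gelt t)) gelt_eQ0 //.
by rewrite (mulrA (e i)) eQ_mul_eQ0 ?mul0r // chain_subS.
Qed.

Lemma chain_orth i t t' : (i < n)%N -> t \in T i -> t' \in T i -> t != t' ->
  gconj (e i) t * gconj (e i) t' = 0.
Proof.
move=> lt_in Tt Tt' neq_t; have [tr _] := trT lt_in.
have sT := subsetP (transversal_sub tr).
case: chainHc => _ _ /(_ i lt_in)[_ _]; apply; rewrite ?sT //.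
by apply: contra_neq neq_t; apply: transversal_inj tr _ _ Tt Tt'.
Qed.

(** [gconj_sum_eQ] gives proportionality, the stabilizer merely repeating each conjugate; both sides
    are idempotents, so [proportional_idempotents] concludes. *)
Lemma chain_next i : (i < n)%N -> e i.+1 = \sum_(t in T i) gconj (e i) t.
Proof.
move=> lt_in; have [tr T1] := trT lt_in; set f := \sum_(t in T i) _.
have Dk : 'chi_(cfIirr ('Ind[Hc i.+1] lambda)) =
    'Ind[Hc i.+1] 'chi_(cfIirr ('Ind[Hc i] lambda)).
  by rewrite !cfIirrE ?chain_irr ?(ltnW lt_in) // cfIndInd ?chain_subS ?sHHc // ltnW.
have [c Dc] := gconj_sum_eQ (chain_subS lt_in) Dk.
have f_idem : f * f = f.
  rewrite /f mulr_suml; apply: eq_bigr => t Tt; rewrite mulr_sumr (bigD1 t) //=.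
  rewrite -gconj_mul chain_e_idem big1 ?addr0 // => s /andP[Ts neq_s].
  by rewrite chain_orth // eq_sym.
have ef : e i * f = e i.
  rewrite /f mulr_sumr (bigD1 1%g) //= gconj1 chain_e_idem big1 ?addr0 // => t.
  by case/andP=> Tt neq_t; rewrite -{1}(gconj1 (e i)) chain_orth // eq_sym.
have nz_f : f != 0.
  by apply: contraNneq (chain_e_neq0 lambda Hc i) => f0; rewrite -ef f0 mulr0.
apply/esym/(@proportional_idempotents _ _ _ _ (#|chain_C lambda Hc i|%:R^-1 * c)) => //.
  exact: chain_e_idem.
rewrite -scalerA -Dc [X in _ *: X](sum_gconj_transversal tr) -scaler_nat scalerA.
rewrite mulVf ?scale1r //.
by rewrite Num.Theory.pnatr_eq0 -lt0n (cardG_gt0 (gcent_group _ _)).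
Qed.

End ChainHypotheses.

(** * Dimension count *)

Lemma dim_ffun (K : fieldType) (I : finType) (W : vectType K) :
  \dim {:{ffun I -> W}} = (#|I| * \dim {:W})%N.
Proof. by rewrite !dimvf. Qed.

Section Dimensions.

Variables (K : fieldType) (aT : falgType K) (I : finType).
Variables (F V : {vspace aT}) (b : I -> aT).

(** [F] is only a subspace, so families over [F] are counted through this [K]-linear map from the
    families of elements of [F]. *)
Let comb (c : {ffun I -> subvs_of F}) : aT := \sum_i vsval (c i) * b i.

Let comb_linear : linear comb.
Proof.
move=> k c d; rewrite /comb scaler_sumr -big_split; apply: eq_bigr => i _.
by rewrite !ffunE linearP mulrDl scalerAl.
Qed.

Let combL : {linear {ffun I -> subvs_of F} -> aT} :=
  HB.pack comb (GRing.isLinear.Build _ _ _ _ comb comb_linear).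

Let combE c : linfun combL c = \sum_i vsval (c i) * b i.
Proof. by rewrite lfunE. Qed.

Let dim_dom : \dim {:{ffun I -> subvs_of F}} = (#|I| * \dim F)%N.
Proof. by rewrite dim_ffun dimvf. Qed.

Lemma dim_span_le :
    (forall v, v \in V -> exists2 c : I -> aT,
       forall i, c i \in F & v = \sum_i c i * b i) ->
  (\dim V <= #|I| * \dim F)%N.
Proof.
move=> spanV; rewrite -dim_dom -(limg_ker_dim (linfun combL) fullv).
apply: leq_trans (leq_addl _ _); apply/dimvS/subvP=> v /spanV[c Fc ->].
apply/memv_imgP; exists [ffun i => vsproj F (c i)]; rewrite ?memvf // combE.
by apply: eq_bigr => i _; rewrite ffunE vsprojK.
Qed.

Lemma dim_free_ge :
    (forall c : I -> aT, (forall i, c i \in F) -> \sum_i c i * b i \in V) ->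
    (forall c : I -> aT, (forall i, c i \in F) -> \sum_i c i * b i = 0 ->
       forall i, c i = 0) ->
  (#|I| * \dim F <= \dim V)%N.
Proof.
move=> inV freeb; rewrite -dim_dom -(limg_ker_dim (linfun combL) fullv).
have ->: lker (linfun combL) = 0%VS.
  apply/eqP; rewrite -subv0; apply/subvP=> c; rewrite memv_ker combE memv0 => /eqP c0.
  apply/eqP/ffunP=> i; apply: val_inj; rewrite /= ffunE.
  by apply: (freeb (fun i => vsval (c i))) => // j; apply: subvsP.
rewrite capv0 dimv0 add0n; apply/dimvS/subvP=> _ /memv_imgP[c _ ->].
by rewrite combE inV // => i; apply: subvsP.
Qed.

End Dimensions.

(** [isom_matrix_algebra] provides an additive map only; over the rationals additivity already
    implies linearity. *)
Lemma additive_bij_dim (U W : vectType rat) (A : {vspace U}) (f : U -> W) :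
    {in A &, {morph f : x y / x + y}} -> {in A &, injective f} ->
    (forall w, exists2 x, x \in A & f x = w) ->
  \dim A = \dim {:W}.
Proof.
move=> addf injf surjf; pose g (x : subvs_of A) := f (vsval x).
have g_add : zmod_morphism g.
  move=> x y; apply/eqP; rewrite eq_sym subr_eq /g -addf ?subvsP //.
  by rewrite -linearD subrK.
have g0 : g 0 = 0 by rewrite -(subrr 0) g_add subrr.
have g_lin : linear g.
  move=> k x y; have := g_add (k *: x) (- y); rewrite opprK => ->.
  have := g_add 0 y; rewrite g0 !sub0r => ->; rewrite opprK.
  by rewrite (rat_linear g_add).
pose gL : {linear subvs_of A -> W} :=
  HB.pack g (GRing.isLinear.Build _ _ _ _ g g_lin).
have gE x : linfun gL x = f (vsval x) by rewrite lfunE.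
have limg_g : limg (linfun gL) = fullv.
  apply/eqP; rewrite eqEsubv subvf; apply/subvP=> w _; have [x Ax Dw] := surjf w.
  by apply/memv_imgP; exists (vsproj A x); rewrite ?memvf // gE vsprojK.
rewrite -limg_g limg_dim_eq ?dimvf //; apply/eqP; rewrite capfv -subv0.
apply/subvP=> x; rewrite memv_ker gE memv0 => /eqP fx0.
have f0 : f 0 = 0 by rewrite -g0 /g linear0.
apply/eqP/subvs_inj; rewrite linear0; apply: injf; rewrite ?subvsP ?mem0v //.
by rewrite fx0 f0.
Qed.

Lemma schur_index1_mul (D : falgType rat) : division_algebra D ->
  (1 ^ 2)%N = (\dim_('Z({:D})) {:D})%N -> forall x y : D, x * y = y * x.
Proof.
move=> divD dimD x y.
suffices /centvP cx : x \in 'C({:D})%VS by apply/cx/memvf.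
(* The relative dimension is a truncated quotient, so divisibility is needed before it can be read
   as an equality. *)
have dvdZ : (\dim 'Z({:D}) %| \dim {:D})%N.
  apply: (@skew_field_module_dimS _ _ divD 'Z({:D})%AS fullv).
  exact: subvf.
suffices ZD : 'Z({:D})%VS = fullv.
  have: x \in 'Z({:D})%VS by rewrite ZD memvf.
  by rewrite memv_cap => /andP[].
by apply/eqP; rewrite eqEdim subvf /= -(divnK dvdZ) -dimD mul1n.
Qed.

Lemma central_mx_scalar (R : nzRingType) m (N : 'M[R]_m.+1) :
  (forall M, N *m M = M *m N) -> N = (N 0 0)%:M.
Proof.
move=> cN; have cij i j k l := congr1 (fun M : 'M_m.+1 => M k l) (cN (delta_mx i j)).
have ent i j k l : (N k i *+ (j == l)) = (N j l *+ (k == i)).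
  have := cij i j k l; rewrite !mxE (bigD1 i) //= [X in _ + X]big1 => [|s neq_s].
    rewrite (bigD1 j) //= [X in _ = _ + X]big1 => [|s neq_s].
      by rewrite !mxE !eqxx !addr0 /= andbT mulr_natr mulr_natl eq_sym.
    by rewrite !mxE (negPf neq_s) andbF mul0r.
  by rewrite !mxE (negPf neq_s) mulr0.
by apply/matrixP=> i j; have := ent j 0 i 0; rewrite eqxx mulr1n mxE.
Qed.

(** Central matrices over the commutative [D] are exactly the scalar ones, so reading the entry
    [0 0] identifies [Z] with [D]. Size [m = 0] is excluded by [e != 0]. *)
Lemma dim_matrix_algebra (aT : falgType rat) (A Z : {vspace aT}) e m
    (D : falgType rat) :
    e \in A -> e != 0 -> {in A &, forall x y, x * y \in A} ->
    (forall x, x \in Z <-> x \in A /\ {in A, forall y, x * y = y * x}) ->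
    (forall x y : D, x * y = y * x) -> isom_matrix_algebra A m D ->
  \dim A = (m ^ 2 * \dim Z)%N.
Proof.
move=> Ae nz_e AM ZP commD [f [addf mulf injf surjf]].
have f0 : f 0 = 0.
  by apply: (addrI (f 0)); rewrite -addf ?mem0v // !addr0.
have f_dim : \dim A = (m ^ 2 * \dim {:D})%N.
  pose h x : {ffun 'I_m * 'I_m -> D} := [ffun p => f x p.1 p.2].
  rewrite (@additive_bij_dim _ _ A h) ?dim_ffun => [|x y Ax Ay|x y Ax Ay eq_h|w].
  - by rewrite card_prod card_ord -mulnn.
  - by apply/ffunP=> p; rewrite !ffunE addf // mxE.
  - apply: injf => //; apply/matrixP=> i j.
    by move/ffunP/(_ (i, j)): eq_h; rewrite !ffunE.
  have [x Ax Dx] := surjf (\matrix_(i, j) w (i, j)); exists x => //.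
  by apply/ffunP=> -[i j]; rewrite ffunE Dx mxE.
case: m f addf mulf injf surjf f0 f_dim => [|m] f addf mulf injf surjf f0 ->.
  case/eqP: nz_e; apply: injf; rewrite ?mem0v //.
  by apply/matrixP=> -[].
congr (_ * _)%N; apply/esym/(@additive_bij_dim _ _ Z (fun x => f x 0 0)).
- by move=> x y /ZP[Ax _] /ZP[Ay _]; rewrite addf // mxE.
- have f_scalar x : x \in Z -> f x = (f x 0 0)%:M.
    case/ZP=> Ax cx; apply: central_mx_scalar => M; have [y Ay <-] := surjf M.
    by rewrite -!mulf // cx.
  move=> x y Zx Zy /= eq_xy; have [[Ax _] [Ay _]] := ((ZP x).1 Zx, (ZP y).1 Zy).
  by apply: injf; rewrite // (f_scalar x) // (f_scalar y) // eq_xy.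
move=> d; have [x Ax Dx] := surjf d%:M; exists x; last by rewrite Dx mxE.
apply/ZP; split=> // y Ay; apply: injf; rewrite ?AM // !mulf // Dx.
apply/matrixP=> i j; rewrite mul_scalar_mx !mxE (bigD1 j) //= big1 => [|k neq_k].
  by rewrite mxE eqxx addr0 commD.
by rewrite mxE (negPf neq_k) mulr0.
Qed.

(** * Matrix units of the component and their number *)

Theorem theorem3p5 (gT : finGroupType) (G H K : {group gT})
    (lambda : 'CF(H)) (n : nat) (Hc : nat -> {group gT}) (T : nat -> {set gT})
    (hHK : generalized_strong_shoda_pair G H K)
    (hlambda : lambda \is a linear_char) (hker : cfker lambda = K)
    (hchain : strong_inductive_chain lambda Hc G n)
    (hT : forall i, (i < n)%N ->
       is_transversal (T i) (rcosets (chain_C lambda Hc i) (Hc i.+1)) (Hc i.+1)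
       /\ 1%g \in T i)
    (hSchur : schur_index (component lambda G) 1)
    (sigma : 'I_(chain_kk lambda Hc n) -> 'End(galg gT)) (w : galg gT)
    (z zinv a : 'I_(chain_kk lambda Hc n) -> galg gT) (alphainv : galg gT) :
  let kk := chain_kk lambda Hc n in
  let e := ind_idem lambda G in
  let EE := diag_E lambda Hc T n in
  let FF := center_F lambda Hc n in
  let Cen := cent_B lambda Hc T n in
  let alpha : galg gT := \sum_i a i * z i in
  let Ehat : galg gT := kk%:R^-1 *: \sum_i z i in
  galois_enumeration EE FF sigma ->
  (forall i : 'I_kk, i = 0%N :> nat -> {in EE, sigma i =1 id}) ->
  normal_element EE FF sigma w ->
  (forall i, inverse_in Cen e (z i) (zinv i)) ->
  left_basis EE Cen z ->
  (forall i, a i \in EE) ->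
  \sum_i a i * sigma i w = \sum_i sigma i w ->
  (forall j : 'I_kk, (0 < j)%N ->
     \sum_i a i * sigma i (sigma j w) = w - sigma j w) ->
  inverse_in Cen e alpha alphainv ->
  complete_primitive_idempotents Cen e
    (fun i => zinv i * alphainv * Ehat * alpha * z i) ->
  complete_matrix_units (component lambda G) e
    (setX (\prod_(i < n) T i)%g [set: 'I_kk])
    (fun r c => gelt r.1^-1 * zinv r.2 * alphainv * Ehat * varepsilon H K
                * alpha * z c.2 * gelt c.1).
Proof.
case: hHK => pairHK _; have [Hc0 Hcn _] := hchain.
move: hchain pairHK hSchur; rewrite -Hcn => hchain pairHK hSchur.
move=> kk e EE FF Cen alpha Ehat _ _ [_ [EEw freeE spanE]] z_inv.
move=> [Cz _ spanC] _ _ _ [Calpha Calphainv alphaK alphaVK].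
move=> [idem orth sum_idem _].
have kk_gt0 : (0 < kk)%N.
  by apply: prodn_gt0 => i; apply: (cardG_gt0 (gcent_group _ _ / _)%G).
have FFe : e \in FF := chain_e_FF lambda Hc n.
have nz_e : e != 0 := chain_e_neq0 lambda Hc n.
(* In a zero [EE] all [sigma i w] vanish, and freeness applied to the constant coefficients [e]
   would give [e = 0]. *)
have nzEE : EE != 0%VS.
  apply: contraNneq nz_e => EE0; apply/eqP.
  apply: (freeE (fun=> e)) (Ordinal kk_gt0) => //.
  by rewrite big1 // => i _; have := EEw i; rewrite EE0 memv0 => /eqP->; rewrite mulr0.
have sHc := chain_subS hchain.
have sT i (lt_in : (i < n)%N) := transversal_sub (hT i lt_in).1.
have T1 i (lt_in : (i < n)%N) := (hT i lt_in).2.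
have e_next := chain_next pairHK hlambda hker hchain hT nzEE.
have e_orth := chain_orth hchain hT.
have De0 : varepsilon H K = chain_e lambda Hc 0.
  rewrite /chain_e Hc0 /ind_idem cfInd_id.
  have irr_lambda := lin_char_irr hlambda.
  by rewrite (@eQ_lin_varepsilon _ H K) ?cfIirrE //; case: pairHK.
have CenM c d : c \in Cen -> d \in Cen -> c * d \in Cen.
  exact: (cent_B_mul sHc sT T1 e_next e_orth).
have idC c : c \in Cen -> e * c = c /\ c * e = c.
  exact: (cent_identity sHc sT T1 e_next e_orth).
have CEhat : Ehat \in Cen by rewrite memvZ ?rpred_sum.
have [Czinv zK zVK] : [/\ forall i, zinv i \in Cen, forall i, z i * zinv i = e
                        & forall i, zinv i * z i = e].
  by split=> i; case: (z_inv i).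
pose P := alphainv * Ehat * alpha; have CP : P \in Cen by rewrite !CenM.
pose c i j := zinv i * P * z j; have Cc i j : c i j \in Cen by rewrite !CenM.
have c_diag i : zinv i * alphainv * Ehat * alpha * z i = c i i.
  by rewrite /c /P !mulrA.
have PP : P * P = P.
  (* Conjugating the idempotent [c i i] back by the unit [z i] gives [P]; any index will do. *)
  have [_ _] := idem (Ordinal kk_gt0); rewrite c_diag; set i := Ordinal _.
  move/(congr1 (fun x => z i * x * zinv i)).
  have ->: z i * (c i i * c i i) * zinv i =
      z i * zinv i * P * (z i * zinv i) * P * (z i * zinv i) by rewrite /c !mulrA.
  have ->: z i * c i i * zinv i = z i * zinv i * P * (z i * zinv i).
    by rewrite /c !mulrA.
  by rewrite zK (idC _ CP).1 !(idC _ CP).2 -mulrA (idC _ CP).2.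
have c_mul i j r l : c i j * c r l = if j == r then c i l else 0.
  rewrite /c; case: eqVneq => [<- | neq_jr].
    transitivity (zinv i * (P * (z j * zinv j) * P) * z l); first by rewrite !mulrA.
    by rewrite zK (idC _ CP).2 PP.
  (* The outer units are stripped from [c j j * c r r = 0], which leaves a relation reusable for
     every [i] and [l]. *)
  have /(congr1 (fun x => z j * x * zinv r)) := orth j r neq_jr.
  rewrite !c_diag mulr0 mul0r /c => orth0.
  have {}orth0 : P * z j * zinv r * P = 0.
    have CX : P * z j * zinv r * P \in Cen by rewrite !CenM.
    rewrite -[RHS]orth0.
    transitivity (z j * zinv j * (P * z j * zinv r * P) * (z r * zinv r)).
      by rewrite !zK (idC _ CX).1 (idC _ CX).2.
    by rewrite !mulrA.
  transitivity (zinv i * (P * z j * zinv r * P) * z l); first by rewrite !mulrA.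
  by rewrite orth0 mulr0 mul0r.
have c_sum : \sum_i c i i = e by rewrite -sum_idem; apply: eq_bigr => i _; rewrite c_diag.
pose TT := (\prod_(i < n) T i)%g.
have inJ r : (r \in setX TT [set: 'I_kk]) = (r.1 \in TT).
  by case: r => t i; rewrite in_setX inE andbT.
have uE r s : r.1 \in TT -> s.1 \in TT ->
    gelt r.1^-1 * zinv r.2 * alphainv * Ehat * varepsilon H K * alpha * z s.2 * gelt s.1
    = c r.2 s.2 * (gelt r.1^-1 * chain_e lambda Hc 0 * gelt s.1).
  move=> TTr TTs; rewrite -(cent_mul_mxunit sHc sT T1 e_next e_orth) // De0.
  have Caz : alpha * z s.2 \in Cen by rewrite CenM.
  transitivity (gelt r.1^-1 * zinv r.2 * alphainv * Ehat *
    (chain_e lambda Hc 0 * (alpha * z s.2)) * gelt s.1); first by rewrite !mulrA.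
  by rewrite -(cent_e0 sHc sT T1 e_next e_orth Caz) /c /P !mulrA.
split.
- move=> r s; rewrite !inJ => TTr TTs; rewrite uE //.
  exact: (tensor_mxunit_V sHc sT T1 e_next e_orth Cc).
- move=> r s p q; rewrite !inJ => TTr TTs TTp TTq; rewrite !uE //.
  exact: (tensor_mxunit_mul sHc sT T1 e_next e_orth Cc c_mul).
- rewrite -[RHS](tensor_mxunit_sum sHc sT T1 e_next e_orth c_sum).
  by apply: eq_bigr => r; rewrite inJ => TTr; rewrite uE.
have [m [D [divD isoD dimD]]] := hSchur; exists D; split=> //.
(* The algebra [D] is the one given by the Schur index; what remains is that its matrix size [m] is
   the number of indices. *)
suffices <- : m = #|setX TT [set: 'I_kk]| by [].
rewrite cardsX cardsT card_ord; set A := component lambda (Hc n) in isoD *.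
have dimA : \dim A = (m ^ 2 * \dim FF)%N.
  apply: (dim_matrix_algebra _ nz_e _ _ (schur_index1_mul divD dimD) isoD).
  - exact: chain_e_V.
  - exact: chain_VM.
  by move=> x; split=> /center_FP.
have dimEE : (\dim EE <= kk * \dim FF)%N.
  by have := dim_span_le spanE; rewrite card_ord.
have dimC : (\dim Cen <= kk * \dim EE)%N.
  by have := dim_span_le spanC; rewrite card_ord.
have dimA_le : (\dim A <= #|TT| ^ 2 * \dim Cen)%N.
  pose b (p : 'I_#|setX TT TT|) :=
    gelt (enum_val p).1^-1 * chain_e lambda Hc 0 * gelt (enum_val p).2.
  rewrite -mulnn -cardsX -[#|_|]card_ord; apply: (@dim_span_le _ _ _ _ _ b) => x Ax.
  have [d Cd Dx] := chain_V_span sHc sT T1 e_next e_orth Ax.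
  exists (fun p => d (enum_val p).1 (enum_val p).2) => [p|].
    by have := enum_valP p; rewrite inE => /andP[]; apply: Cd.
  rewrite Dx pair_big /=.
  rewrite -[RHS](@big_enum_val _ _ _ _ _ (fun p =>
    d p.1 p.2 * (gelt p.1^-1 * chain_e lambda Hc 0 * gelt p.2))).
  by apply: eq_bigl => p; rewrite inE.
have dimA_ge : ((#|TT| * kk) ^ 2 * \dim FF <= \dim A)%N.
  pose J := setX TT [set: 'I_kk].
  pose u p q := c p.2 q.2 * (gelt p.1^-1 * chain_e lambda Hc 0 * gelt q.1).
  have cardJ : #|J| = (#|TT| * kk)%N by rewrite cardsX cardsT card_ord.
  rewrite -cardJ -mulnn -[X in (X * X)%N]card_ord -card_prod.
  pose b (p : 'I_#|J| * 'I_#|J|) := u (enum_val p.1) (enum_val p.2).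
  have TTe (p : 'I_#|J|) : (enum_val p).1 \in TT by rewrite -inJ enum_valP.
  apply: (@dim_free_ge _ _ _ FF A b) => [d Fd | d Fd d0 [p q]].
    apply: rpred_sum => p _; apply: chain_VM; first by case/center_FP: (Fd p).
    exact: (tensor_mxunit_V sHc sT T1 e_next e_orth Cc).
  have u_mul := tensor_mxunit_mul sHc sT T1 e_next e_orth Cc c_mul.
  have Vu := tensor_mxunit_V sHc sT T1 e_next e_orth Cc.
  have mul4 (x1 x2 x3 x4 : galg gT) : x1 * (x2 * x3) * x4 = x1 * x2 * (x3 * x4).
    by rewrite !mulrA.
  have dE p' y : y \in A -> d p' * y = y * d p'.
    by case/center_FP: (Fd p') => _; apply.
  (* Multiplying the relation by [u t p] on the left and [u q t] on the right isolates the
     coefficient at [(p, q)], as the [d p'] are central in [A]. *)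
  have du t : t \in J -> d (p, q) * u t t = 0.
    rewrite inJ => TTt; have := congr1 (fun x => u t (enum_val p) * x * u (enum_val q) t) d0.
    rewrite mulr0 mul0r mulr_sumr mulr_suml => sum0; rewrite -[RHS]sum0.
    have term p' q' : u t (enum_val p) * (d (p', q') * b (p', q')) * u (enum_val q) t =
        if (p' == p) && (q' == q) then d (p, q) * u t t else 0.
      transitivity (u t (enum_val p) * d (p', q') * (b (p', q') * u (enum_val q) t)).
        exact: mul4.
      rewrite -dE ?Vu // -[LHS]mulrA [b _ * _]u_mul // (inj_eq enum_val_inj).
      rewrite [(p', q').2]/= -/(u (enum_val p') t).
      case: eqVneq => [-> | _]; last by rewrite !mulr0 andbF.
      rewrite u_mul // (inj_eq enum_val_inj) eq_sym andbT.
      by case: eqVneq => [-> | _]; rewrite ?mulr0.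
    rewrite (bigD1 (p, q)) //= term !eqxx big1 ?addr0 // => -[p' q'] neq.
    by rewrite term; move: neq; rewrite xpair_eqE => /negPf->.
  (* Since [e] is the sum of the [u t t], the products killed by [du] add up to the coefficient
     itself. *)
  have <- : d (p, q) * e = d (p, q).
    by case/center_FP: (Fd (p, q)) => /chain_VP[].
  rewrite -[e](tensor_mxunit_sum sHc sT T1 e_next e_orth c_sum) mulr_sumr.
  by apply: big1 => t /du.
have dimFF : (0 < \dim FF)%N.
  rewrite lt0n dimv_eq0; apply: contraNneq nz_e => FF0.
  by move: FFe; rewrite FF0 memv0.
(* Both sides are squared and multiplied by the nonzero [\dim FF], so that [dimA] turns the equality
   of sizes into the two bounds on [\dim A]. *)
apply/eqP; rewrite -(eqn_exp2r _ _ (isT : 0 < 2)%N) -(eqn_pmul2r dimFF) -dimA.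
rewrite eqn_leq dimA_ge andbT; apply: leq_trans dimA_le _.
rewrite expnMn -mulnA leq_mul2l; apply/orP; right.
by apply: leq_trans dimC _; rewrite -mulnn -mulnA leq_mul2l dimEE orbT.
Qed.
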